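(* Let $A_1,\dots,A_n\in\Omega^-$, $\Gamma=x_1:A_1,\dots,x_n:A_n$, $A\in\Omega^+$, and let $t$ be a normal λ-term. If $\Gamma\vdash_{TTR}t:A$, then $\Gamma\vdash_{TTR_0}t:A$, and in this $TTR_0$ typing each variable is assigned a $\forall$-negative type and each $u\in STE(t)$ is typable with a $\forall$-positive type.
   Context: $TTR$ types: over a second-order language with first-order variables, function symbols, $n$-ary predicate variables and symbols, and a fixed system $\mathbf E$ of equations; atomic $\perp$ and $X(t_1,\dots,t_n)$; constructors $\to$, $\forall x$, $\forall X$, and $\mu Cx_1\dots x_nA\langle t_1,\dots,t_n\rangle$ for $C$ an $n$-ary predicate symbol occurring and positive in $A$. Subtyping $\subseteq$ is the least relation closed under: $A\subseteq A$; from $A\subseteq A'$, $B\subseteq B'$ infer $A'\to B\subseteq A\to B'$; ($\forall i_g$) from $A[G/v]\subseteq B$ infer $\forall vA\subseteq B$ ($G$ a term if $v$ is first-order, a formula if $v$ a predicate variable); from $A\subseteq B$ infer $A\subseteq\forall vB$ if $v$ not free in $A$; from $A\subseteq B[v/y]$ infer $A\subseteq B[w/y]$ if $v=w$ is an instance of an equation of $\mathbf E$; transitivity; $D[\mu C\bar xD\langle\bar z\rangle/C(\bar z)][\bar t/\bar x]\subseteq\mu C\bar xD\langle\bar t\rangle$ and its converse; from $D[E/C(\bar x)]\subseteq E$ infer $\mu C\bar xD\langle\bar t\rangle\subseteq E[\bar t/\bar x]$. Typing $\vdash_{TTR}$ has rules: (1) $\Gamma,x:A\vdash x:A$; (2)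 $\to$-introduction; (3) $\to$-elimination; (4) $\forall x$-introduction ($x$ not in $\Gamma$); (5) $\forall x$-elimination by any term; (6) $\forall X$-introduction ($X$ not in $\Gamma$); (7) $\forall X$-elimination $\forall XA\Rightarrow A[G/X(x_1,\dots,x_n)]$; (8) from $t:A[u/x]$ infer $t:A[v/x]$ for $u=v$ an instance of an equation of $\mathbf E$; ($\subseteq$) from $t:A$, $A\subseteq B$ infer $t:B$; (Y) from $\Gamma\vdash t:\forall\bar x[C(\bar x)\to E]\to\forall\bar x[D\to E]$ infer $\Gamma\vdash(Y)t:\forall\bar x[\mu C\bar xD\langle\bar x\rangle\to E]$ ($C$ not free in $E$ nor $\Gamma$; $Y$ Turing's fixed point combinator). $A\subseteq_0B$ means $A\subseteq B$ is derivable using ($\forall i_g$) only with $G$ a term (if $v$ is first-order) or a predicate variable or predicate symbol of the same arity as $v$ (if $v$ is a predicate variable). $TTR_0$ is $TTR$ without rules (5), (7), (8) and with ($\subseteq$) replaced by: from $t:A$ and $A\subseteq_0B$ infer $t:B$. $\Omega^+$, $\Omega^-$: atomic types are in both; $T^-\to T^+\in\Omega^+$ and $T^+\to T^-\in\Omega^-$ for $T^\pm\in\Omega^\pm$; $\forall xT^+,\forall XT^+\in\Omega^+$; $\forall xT^-\in\Omega^-$, and $\forall XT^-\in\Omega^-$ if $X$ not free in $T^-$; $\mu C\bar xT^+\langle\bar t\rangle\in\Omega^+$ for $C$ occurring and positive in $T^+\in\Omega^+$. For a normal λ-term $t=\lambda x_1\dots\lambda x_n(y)t_1\dots t_m$,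 $STE(t)=\{t\}\cup\bigcup_{1\le i\le m}STE(t_i)$. *)

(* Defs.v *)
From Stdlib Require Import List Arith Bool.
Import ListNotations.

(* (a function symbol is identified by its name and its arity).         *)
Inductive term : Type :=
| TVar : nat -> term
| TFun : nat -> list term -> term.

Fixpoint ren_term (xi : nat -> nat) (t : term) : term :=
  match t with
  | TVar k => TVar (xi k)
  | TFun f ts => TFun f (map (ren_term xi) ts)
  end.

Fixpoint subst_term (sigma : nat -> term) (t : term) : term :=
  match t with
  | TVar k => sigma k
  | TFun f ts => TFun f (map (subst_term sigma) ts)
  end.

Definition upren (xi : nat -> nat) : nat -> nat :=
  fun k => match k with 0 => 0 | S k' => S (xi k') end.
Fixpoint uprenn (n : nat) (xi : nat -> nat) : nat -> nat :=
  match n with 0 => xi | S n' => upren (uprenn n' xi) end.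
Definition up (sigma : nat -> term) : nat -> term :=
  fun k => match k with 0 => TVar 0 | S k' => ren_term S (sigma k') end.
Fixpoint upn (n : nat) (sigma : nat -> term) : nat -> term :=
  match n with 0 => sigma | S n' => up (upn n' sigma) end.

(*  PVar i args : predicate variable, de Bruijn index i among the       *)
(*                predicate binders of arity (length args)              *)
(*  All2 n A    : forall X A  (X of arity n)                            *)
(*  Mu D ts     : mu C x1..xn D <t1..tn>, n = length ts; in D the       *)
(*                predicate index 0 of arity n is C and the first-order *)
(*                indices n-1, ..., 0 are x1, ..., xn.                  *)
Inductive formula : Type :=
| Bot : formula
| PVar : nat -> list term -> formula
| PSym : nat -> list term -> formula
| Imp : formula -> formula -> formula
| All1 : formula -> formula
| All2 : nat -> formula -> formula
| Mu : formula -> list term -> formula.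

Fixpoint ren_fo (xi : nat -> nat) (A : formula) : formula :=
  match A with
  | Bot => Bot
  | PVar i args => PVar i (map (ren_term xi) args)
  | PSym c args => PSym c (map (ren_term xi) args)
  | Imp A B => Imp (ren_fo xi A) (ren_fo xi B)
  | All1 A => All1 (ren_fo (upren xi) A)
  | All2 n A => All2 n (ren_fo xi A)
  | Mu D args => Mu (ren_fo (uprenn (length args) xi) D) (map (ren_term xi) args)
  end.

Definition upren_pr (n : nat) (rho : nat -> nat -> nat) : nat -> nat -> nat :=
  fun m i => if m =? n then upren (rho m) i else rho m i.

Fixpoint ren_pr (rho : nat -> nat -> nat) (A : formula) : formula :=
  match A with
  | Bot => Bot
  | PVar i args => PVar (rho (length args) i) args
  | PSym c args => PSym c args
  | Imp A B => Imp (ren_pr rho A) (ren_pr rho B)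
  | All1 A => All1 (ren_pr rho A)
  | All2 n A => All2 n (ren_pr (upren_pr n rho) A)
  | Mu D args => Mu (ren_pr (upren_pr (length args) rho) D) args
  end.

Fixpoint fsubst (sigma : nat -> term) (A : formula) : formula :=
  match A with
  | Bot => Bot
  | PVar i args => PVar i (map (subst_term sigma) args)
  | PSym c args => PSym c (map (subst_term sigma) args)
  | Imp A B => Imp (fsubst sigma A) (fsubst sigma B)
  | All1 A => All1 (fsubst (up sigma) A)
  | All2 n A => All2 n (fsubst sigma A)
  | Mu D args => Mu (fsubst (upn (length args) sigma) D) (map (subst_term sigma) args)
  end.

(* The list of parameters x1..xn of an n-ary abstraction: indices n-1,...,0. *)
Definition params (n : nat) : list term := rev (map TVar (seq 0 n)).

(* substitution sending the parameters x1..xn (indices n-1..0) to t1..tn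
   and the other indices k >= n to k - n *)
Definition args_subst (ts : list term) : nat -> term :=
  fun k => nth k (rev ts) (TVar (k - length ts)).

(* A predicate abstraction of arity n is a formula G whose first-order
   indices n-1..0 are its parameters x1..xn; G[t1..tn/x1..xn]: *)
Definition inst_abs (G : formula) (ts : list term) : formula :=
  fsubst (args_subst ts) G.

Definition pid (m i : nat) : formula := PVar i (params m).

Definition lift_abs (n d : nat) (G : formula) : formula :=
  ren_fo (fun k => if k <? n then k else k + d) G.

Definition shift_pr (n : nat) : nat -> nat -> nat :=
  fun m i => if m =? n then S i else i.

Definition up_pr (n : nat) (tau : nat -> nat -> formula) : nat -> nat -> formula :=
  fun m i =>
    if m =? n then
      match i with 0 => pid m 0 | S i' => ren_pr (shift_pr n) (tau m i') end
    else ren_pr (shift_pr n) (tau m i).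

Fixpoint subst_form (sigma : nat -> term) (tau : nat -> nat -> formula)
  (A : formula) : formula :=
  match A with
  | Bot => Bot
  | PVar i args => inst_abs (tau (length args) i) (map (subst_term sigma) args)
  | PSym c args => PSym c (map (subst_term sigma) args)
  | Imp A B => Imp (subst_form sigma tau A) (subst_form sigma tau B)
  | All1 A => All1 (subst_form (up sigma) (fun m i => lift_abs m 1 (tau m i)) A)
  | All2 n A => All2 n (subst_form sigma (up_pr n tau) A)
  | Mu D args =>
      Mu (subst_form (upn (length args) sigma)
            (fun m i => lift_abs m (length args) (up_pr (length args) tau m i)) D)
         (map (subst_term sigma) args)
  end.

Definition inst1 (A : formula) (u : term) : formula :=
  fsubst (fun k => match k with 0 => u | S k' => TVar k' end) A.

Definition pscons (n : nat) (G : formula) : nat -> nat -> formula :=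
  fun m i =>
    if m =? n then match i with 0 => G | S i' => pid m i' end else pid m i.

Definition inst2 (n : nat) (A : formula) (G : formula) : formula :=
  subst_form TVar (pscons n G) A.

Definition shift1 (A : formula) : formula := ren_fo S A.
Definition shift2 (n : nat) (A : formula) : formula := ren_pr (shift_pr n) A.

(* D[mu C x D<z>/C(z)][t/x] *)
Definition unfold_mu (D : formula) (ts : list term) : formula :=
  subst_form (args_subst ts)
    (pscons (length ts) (Mu (lift_abs (length ts) (length ts) D) (params (length ts))))
    D.

Definition alln (n : nat) (A : formula) : formula := Nat.iter n All1 A.

Fixpoint has_occ (m i : nat) (b : bool) (A : formula) : bool :=
  match A with
  | Bot => false
  | PVar j args => b && (j =? i) && (length args =? m)
  | PSym _ _ => false
  | Imp A B => has_occ m i (negb b) A || has_occ m i b B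
  | All1 A => has_occ m i b A
  | All2 n A => has_occ m (if n =? m then S i else i) b A
  | Mu D args => has_occ m (if length args =? m then S i else i) b D
  end.

Definition occurs (m i : nat) (A : formula) : bool :=
  has_occ m i true A || has_occ m i false A.
Definition positive (m i : nat) (A : formula) : bool :=
  negb (has_occ m i false A).

Fixpoint wf (A : formula) : Prop :=
  match A with
  | Bot | PVar _ _ | PSym _ _ => True
  | Imp A B => wf A /\ wf B
  | All1 A => wf A
  | All2 _ A => wf A
  | Mu D args =>
      occurs (length args) 0 D = true /\ positive (length args) 0 D = true /\ wf D
  end.

Inductive Omega_pos : formula -> Prop :=
| Opos_bot : Omega_pos Bot
| Opos_var i args : Omega_pos (PVar i args)
| Opos_sym c args : Omega_pos (PSym c args)
| Opos_imp A B : Omega_neg A -> Omega_pos B -> Omega_pos (Imp A B)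
| Opos_all1 A : Omega_pos A -> Omega_pos (All1 A)
| Opos_all2 n A : Omega_pos A -> Omega_pos (All2 n A)
| Opos_mu D ts : occurs (length ts) 0 D = true -> positive (length ts) 0 D = true ->
    Omega_pos D -> Omega_pos (Mu D ts)
with Omega_neg : formula -> Prop :=
| Oneg_bot : Omega_neg Bot
| Oneg_var i args : Omega_neg (PVar i args)
| Oneg_sym c args : Omega_neg (PSym c args)
| Oneg_imp A B : Omega_pos A -> Omega_neg B -> Omega_neg (Imp A B)
| Oneg_all1 A : Omega_neg A -> Omega_neg (All1 A)
| Oneg_all2 n A : occurs n 0 A = false -> Omega_neg A -> Omega_neg (All2 n A).

(* E l r : "l = r" is an equation of the system E.  u = v is an instance
   of an equation of E (equations are read symmetrically). *)
Definition eq_inst (E : term -> term -> Prop) (u v : term) : Prop :=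
  exists l r (sigma : nat -> term),
    (E l r \/ E r l) /\ u = subst_term sigma l /\ v = subst_term sigma r.

(* Subtyping; r = true gives the restricted relation  (subseteq_0)      *)
Definition restricted (n : nat) (G : formula) : Prop :=
  (exists j, G = PVar j (params n)) \/ (exists c, G = PSym c (params n)).

Inductive sub (r : bool) (E : term -> term -> Prop) : formula -> formula -> Prop :=
| s_refl A : wf A -> sub r E A A
| s_arrow A A' B B' : wf (Imp A' B) -> wf (Imp A B') ->
    sub r E A A' -> sub r E B B' -> sub r E (Imp A' B) (Imp A B')
| s_all1_l A B u : wf (All1 A) -> wf B ->
    sub r E (inst1 A u) B -> sub r E (All1 A) B
| s_all2_l n A B G : wf (All2 n A) -> wf B ->
    (r = true -> restricted n G) ->
    sub r E (inst2 n A G) B -> sub r E (All2 n A) B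
| s_all1_r A B : wf A -> wf (All1 B) ->
    sub r E (shift1 A) B -> sub r E A (All1 B)
| s_all2_r n A B : wf A -> wf (All2 n B) ->
    sub r E (shift2 n A) B -> sub r E A (All2 n B)
| s_eq A B u v : wf A -> wf (inst1 B v) -> eq_inst E u v ->
    sub r E A (inst1 B u) -> sub r E A (inst1 B v)
| s_trans A B C : wf A -> wf C -> sub r E A B -> sub r E B C -> sub r E A C
| s_fold D ts : wf (unfold_mu D ts) -> wf (Mu D ts) ->
    sub r E (unfold_mu D ts) (Mu D ts)
| s_unfold D ts : wf (Mu D ts) -> wf (unfold_mu D ts) ->
    sub r E (Mu D ts) (unfold_mu D ts)
| s_ind D ts Ef : wf (Mu D ts) -> wf (inst_abs Ef ts) ->
    sub r E (subst_form TVar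
               (pscons (length ts) (lift_abs (length ts) (length ts) Ef)) D) Ef ->
    sub r E (Mu D ts) (inst_abs Ef ts).

Inductive lterm : Type :=
| LVar : nat -> lterm
| LApp : lterm -> lterm -> lterm
| LLam : nat -> lterm -> lterm.

(* Turing's fixed point combinator (lam x lam y (y)((x)x)y)(lam x lam y (y)((x)x)y) *)
Definition turing_half : lterm :=
  LLam 0 (LLam 1 (LApp (LVar 1) (LApp (LApp (LVar 0) (LVar 0)) (LVar 1)))).
Definition Ycomb : lterm := LApp turing_half turing_half.

Inductive neutral : lterm -> Prop :=
| ne_var y : neutral (LVar y)
| ne_app u v : neutral u -> normal v -> neutral (LApp u v)
with normal : lterm -> Prop :=
| nf_ne u : neutral u -> normal u
| nf_lam x u : normal u -> normal (LLam x u).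

Fixpoint strip_lams (t : lterm) : lterm :=
  match t with LLam _ b => strip_lams b | _ => t end.
Fixpoint app_args (t : lterm) : list lterm :=
  match t with LApp u v => app_args u ++ [v] | _ => [] end.

(* u in STE(t), for t = lam x1..xn (y) t1 .. tm *)
Inductive in_STE : lterm -> lterm -> Prop :=
| ste_self t : in_STE t t
| ste_arg u ti t : In ti (app_args (strip_lams t)) -> in_STE u ti -> in_STE u t.

(* Typing derivations; r = false : TTR,  r = true : TTR_0               *)
Definition ctx := list (nat * formula).   (* most recent declaration first *)

Fixpoint lookup (x : nat) (G : ctx) : option formula :=
  match G with
  | [] => None
  | (y, B) :: G' => if x =? y then Some B else lookup x G'
  end.

Definition wf_ctx (G : ctx) : Prop := Forall (fun p => wf (snd p)) G.
Definition shift1_ctx (G : ctx) : ctx := map (fun p => (fst p, shift1 (snd p))) G.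
Definition shift2_ctx (n : nat) (G : ctx) : ctx :=
  map (fun p => (fst p, shift2 n (snd p))) G.

Inductive deriv (r : bool) (E : term -> term -> Prop) : ctx -> lterm -> formula -> Type :=
| d_ax G x A : wf_ctx G -> wf A -> lookup x G = Some A -> deriv r E G (LVar x) A
| d_lam G x t A B : wf_ctx G -> wf (Imp A B) ->
    deriv r E ((x, A) :: G) t B -> deriv r E G (LLam x t) (Imp A B)
| d_app G t u A B : wf_ctx G -> wf B ->
    deriv r E G t (Imp A B) -> deriv r E G u A -> deriv r E G (LApp t u) B
| d_all1_i G t A : wf_ctx G -> wf (All1 A) ->
    deriv r E (shift1_ctx G) t A -> deriv r E G t (All1 A)
| d_all1_e G t A u : r = false -> wf_ctx G -> wf (inst1 A u) ->
    deriv r E G t (All1 A) -> deriv r E G t (inst1 A u)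
| d_all2_i G t n A : wf_ctx G -> wf (All2 n A) ->
    deriv r E (shift2_ctx n G) t A -> deriv r E G t (All2 n A)
| d_all2_e G t n A Gf : r = false -> wf_ctx G -> wf (inst2 n A Gf) ->
    deriv r E G t (All2 n A) -> deriv r E G t (inst2 n A Gf)
| d_eq G t A u v : r = false -> wf_ctx G -> wf (inst1 A v) -> eq_inst E u v ->
    deriv r E G t (inst1 A u) -> deriv r E G t (inst1 A v)
| d_sub G t A B : wf_ctx G -> wf B -> sub r E A B ->
    deriv r E G t A -> deriv r E G t B
| d_Y G t n D Ef : wf_ctx G ->
    wf (alln n (Imp (Mu (lift_abs n n D) (params n)) Ef)) ->
    deriv r E (shift2_ctx n G) t
      (Imp (alln n (Imp (PVar 0 (params n)) (shift2 n Ef)))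
           (alln n (Imp D (shift2 n Ef)))) ->
    deriv r E G (LApp Ycomb t) (alln n (Imp (Mu (lift_abs n n D) (params n)) Ef)).

Fixpoint judgs {r E G t A} (d : deriv r E G t A) : list (ctx * lterm * formula) :=
  (G, t, A) ::
  match d with
  | d_ax _ _ _ _ _ _ _ _ => []
  | d_lam _ _ _ _ _ _ _ _ _ d1 => judgs d1
  | d_app _ _ _ _ _ _ _ _ _ d1 d2 => judgs d1 ++ judgs d2
  | d_all1_i _ _ _ _ _ _ _ d1 => judgs d1
  | d_all1_e _ _ _ _ _ _ _ _ _ d1 => judgs d1
  | d_all2_i _ _ _ _ _ _ _ _ d1 => judgs d1
  | d_all2_e _ _ _ _ _ _ _ _ _ _ d1 => judgs d1
  | d_eq _ _ _ _ _ _ _ _ _ _ _ d1 => judgs d1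
  | d_sub _ _ _ _ _ _ _ _ _ d1 => judgs d1
  | d_Y _ _ _ _ _ _ _ _ _ d1 => judgs d1
  end.

(* Main.v *)
(* The subtyping relation has no cut elimination that one could use directly (the induction rule
   for mu is itself a cut), so the proof is semantic.  A type is interpreted by a set of formulas
   F and of sequents (G, t), closed under replacing F by anything that reaches F in the restricted
   system: atoms by their down-sets, quantifiers by intersections over terms and over all
   admissible families of such sets, mu by a least fixed point.  Full subtyping and full typing
   of normal terms are sound for this interpretation, where comprehension is harmless.
   Conversely every element of the interpretation of a positive type A lies below A in the
   restricted system, and every negative type belongs to its own interpretation; quantifiers in
   positive position are handled by instantiating them with fresh variables.  Applying soundness
   to the given derivation, in the context itself, gives a restricted derivation.

   The interpretation of an arrow records an intermediate type A' -> B' with A' positive for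
   every neutral term, which is what types the arguments of head variables positively. *)
Require Import Defs.
From Stdlib Require Import List.
Import ListNotations.
From Stdlib Require Import Arith Bool Lia FunctionalExtensionality PropExtensionality.

(** * First-order terms and their simultaneous substitutions *)

(** The automatically generated principle gives no hypothesis for the terms inside the argument
    list, so the nested recursion is written out. *)
Definition term_nested_ind (P : term -> Prop) (HV : forall k, P (TVar k))
    (HF : forall f ts, Forall P ts -> P (TFun f ts)) : forall t, P t :=
  fix ind (t : term) : P t :=
    match t with
    | TVar k => HV k
    | TFun f ts => HF f ts
        ((fix all (l : list term) : Forall P l :=
            match l with
            | [] => Forall_nil P
            | a :: l' => Forall_cons a (ind a) (all l')
            end) ts)
    end.

Lemma subst_term_comp (s1 s2 : nat -> term) (t : term) :
  subst_term s2 (subst_term s1 t) = subst_term (fun k => subst_term s2 (s1 k)) t.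
Proof.
  induction t as [k | f ts IH] using term_nested_ind; cbn; [reflexivity|].
  f_equal. rewrite map_map. apply map_ext_Forall, IH.
Qed.

Lemma subst_term_id (t : term) : subst_term TVar t = t.
Proof.
  induction t as [k | f ts IH] using term_nested_ind; cbn; [reflexivity|].
  f_equal. rewrite <- (map_id ts) at 2. apply map_ext_Forall, IH.
Qed.

Lemma ren_term_subst (xi : nat -> nat) (t : term) :
  ren_term xi t = subst_term (fun k => TVar (xi k)) t.
Proof.
  induction t as [k | f ts IH] using term_nested_ind; cbn; [reflexivity|].
  f_equal. apply map_ext_Forall, IH.
Qed.

Lemma map_subst_term_comp (s1 s2 : nat -> term) (ts : list term) :
  map (subst_term s2) (map (subst_term s1) ts) =
  map (subst_term (fun k => subst_term s2 (s1 k))) ts.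
Proof. rewrite map_map. apply map_ext. intro. apply subst_term_comp. Qed.

Lemma map_subst_term_id (ts : list term) : map (subst_term TVar) ts = ts.
Proof. rewrite <- (map_id ts) at 2. apply map_ext, subst_term_id. Qed.

Definition scons (u : term) (s : nat -> term) : nat -> term :=
  fun k => match k with 0 => u | S k' => s k' end.

(** Common form of several environments: [args_subst] is the case of tail [TVar], [scons] that of a
    one-element list, and in the interpretation it binds the parameters of an abstraction. The list
    is reversed because x1 has the largest index. *)
Definition app_env (ts : list term) (s : nat -> term) : nat -> term :=
  fun k => nth k (rev ts) (s (k - length ts)).

Lemma app_env_eq (ts : list term) (s : nat -> term) (k : nat) :
  app_env ts s k =
  if k <? length ts then nth k (rev ts) (TVar 0) else s (k - length ts).
Proof.
  unfold app_env. destruct (Nat.ltb_spec k (length ts)).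
  - apply nth_indep. now rewrite length_rev.
  - apply nth_overflow. now rewrite length_rev.
Qed.

Lemma args_subst_app_env (ts : list term) : args_subst ts = app_env ts TVar.
Proof. reflexivity. Qed.

(** Closed form of the iterated lift. Through it, identities between substitutions become case
    distinctions on indices settled by arithmetic; [sigma] automates this. *)
Lemma upn_eq (n : nat) (s : nat -> term) (k : nat) :
  upn n s k =
  if k <? n then TVar k else subst_term (fun i => TVar (n + i)) (s (k - n)).
Proof.
  revert k; induction n as [|n IH]; intro k; cbn [upn].
  - cbn. now rewrite Nat.sub_0_r, subst_term_id.
  - destruct k as [|k]; cbn [up]; [reflexivity|].
    rewrite IH, ren_term_subst. change (S k <? S n) with (k <? n).
    destruct (k <? n); cbn; [reflexivity|]. apply subst_term_comp.
Qed.

Lemma scons_app_env (u : term) (s : nat -> term) : scons u s = app_env [u] s.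
Proof.
  extensionality k. destruct k as [|[|k]]; reflexivity.
Qed.

Ltac case_index :=
  repeat match goal with
  | |- context [?a <? ?b] => destruct (Nat.ltb_spec a b); try lia
  | |- context [?a =? ?b] => destruct (Nat.eqb_spec a b); try lia
  end.

Ltac sigma :=
  repeat (progress (cbn [subst_term];
    rewrite ?subst_term_comp, ?upn_eq, ?app_env_eq, ?length_map;
    case_index)); cbn [subst_term].

Lemma nth_rev_map (s : nat -> term) (ts : list term) (k : nat) : k < length ts ->
  nth k (rev (map (subst_term s) ts)) (TVar 0) = subst_term s (nth k (rev ts) (TVar 0)).
Proof.
  intro. rewrite <- map_rev.
  rewrite (nth_indep _ (TVar 0) (subst_term s (TVar 0))).
  - apply map_nth.
  - now rewrite length_map, length_rev.
Qed.

Lemma upn_comp (n : nat) (s1 s2 : nat -> term) :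
  (fun k => subst_term (upn n s2) (upn n s1 k)) = upn n (fun k => subst_term s2 (s1 k)).
Proof.
  extensionality k. sigma; [reflexivity|].
  f_equal. extensionality i. sigma. f_equal. f_equal. lia.
Qed.

Lemma upn_id (n : nat) : upn n TVar = TVar.
Proof. extensionality k. sigma; f_equal; lia. Qed.

Lemma upn_ren (n : nat) (xi : nat -> nat) :
  upn n (fun k => TVar (xi k)) = fun k => TVar (uprenn n xi k).
Proof.
  extensionality k. revert k; induction n as [|n IH]; intro k; [reflexivity|].
  destruct k as [|k]; cbn; [reflexivity|]. rewrite IH. reflexivity.
Qed.

Lemma app_env_subst (ts : list term) (s s' : nat -> term) :
  (fun k => subst_term s' (app_env ts s k)) =
  app_env (map (subst_term s') ts) (fun k => subst_term s' (s k)).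
Proof.
  extensionality k. sigma; [|reflexivity]. now rewrite nth_rev_map.
Qed.

Lemma upn_app_env (ts : list term) (n : nat) (s s' : nat -> term) : length ts = n ->
  (fun k => subst_term (app_env ts s') (upn n s k)) =
  app_env ts (fun k => subst_term s' (s k)).
Proof.
  intro H. extensionality k. sigma; [reflexivity|].
  subst n. f_equal. extensionality i. sigma. f_equal. lia.
Qed.

Lemma length_params (n : nat) : length (params n) = n.
Proof. unfold params. now rewrite length_rev, length_map, length_seq. Qed.

Lemma nth_params (n k : nat) : k < n -> nth k (rev (params n)) (TVar 0) = TVar k.
Proof.
  intro. unfold params. rewrite rev_involutive, map_nth.
  now rewrite seq_nth.
Qed.

Lemma app_env_params (n : nat) (s : nat -> term) :
  app_env (params n) s = fun k => if k <? n then TVar k else s (k - n).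
Proof.
  extensionality k. rewrite app_env_eq, length_params.
  case_index; [now apply nth_params | reflexivity].
Qed.

Lemma map_params_ext (n : nat) (s s' : nat -> term) :
  (forall k, k < n -> s k = s' k) -> map (subst_term s) (params n) = map (subst_term s') (params n).
Proof.
  intro H. unfold params. rewrite !map_rev, !map_map. f_equal.
  apply map_ext_in. intros k Hk. apply in_seq in Hk. cbn. apply H. lia.
Qed.

Lemma map_params_app_env (ts : list term) (s : nat -> term) :
  map (subst_term (app_env ts s)) (params (length ts)) = ts.
Proof.
  unfold params. rewrite map_rev, map_map.
  transitivity (rev (rev ts)); [f_equal | apply rev_involutive].
  apply nth_ext with (d := TVar 0) (d' := TVar 0).
  - now rewrite length_map, length_seq, length_rev.
  - rewrite length_map, length_seq. intros k Hk.
    rewrite (nth_indep _ (TVar 0) (subst_term (app_env ts s) (TVar 0)))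
      by now rewrite length_map, length_seq.
    rewrite (map_nth (fun x => subst_term (app_env ts s) (TVar x)) (seq 0 (length ts)) 0).
    rewrite seq_nth by assumption. sigma. reflexivity.
Qed.

Lemma map_params_upn (n : nat) (s : nat -> term) :
  map (subst_term (upn n s)) (params n) = params n.
Proof.
  transitivity (map (subst_term TVar) (params n)); [|apply map_subst_term_id].
  apply map_params_ext. intros. now sigma.
Qed.

(** * Substitution in formulas *)

Lemma ren_fo_fsubst (xi : nat -> nat) (A : formula) :
  ren_fo xi A = fsubst (fun k => TVar (xi k)) A.
Proof.
  assert (Hm : forall (xi : nat -> nat) ts,
    map (ren_term xi) ts = map (subst_term (fun k => TVar (xi k))) ts).
  { intros. apply map_ext. intro. apply ren_term_subst. }
  revert xi; induction A; intro xi; cbn; f_equal; auto.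
  - rewrite IHA. f_equal. symmetry. apply (upn_ren 1).
  - rewrite IHA. f_equal. symmetry. apply upn_ren.
Qed.

Lemma fsubst_comp (s1 s2 : nat -> term) (A : formula) :
  fsubst s2 (fsubst s1 A) = fsubst (fun k => subst_term s2 (s1 k)) A.
Proof.
  revert s1 s2; induction A; intros s1 s2; cbn; rewrite ?map_subst_term_comp; f_equal; auto.
  - rewrite IHA. f_equal. apply (upn_comp 1).
  - rewrite IHA, length_map. f_equal. apply upn_comp.
Qed.

Lemma fsubst_id (A : formula) : fsubst TVar A = A.
Proof.
  induction A; cbn; rewrite ?map_subst_term_id; f_equal; auto.
  - change (up TVar) with (upn 1 TVar). now rewrite upn_id.
  - now rewrite upn_id.
Qed.

(** The renaming of [lift_abs] as a substitution: the [n] parameters stay, and [d] further binders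
    are skipped beyond them. *)
Definition lift_index (n d : nat) : nat -> term :=
  fun k => TVar (if k <? n then k else k + d).

Lemma lift_abs_fsubst (n d : nat) (G : formula) : lift_abs n d G = fsubst (lift_index n d) G.
Proof. apply ren_fo_fsubst. Qed.

Lemma pid_fsubst (m i : nat) (s : nat -> term) : fsubst (upn m s) (pid m i) = pid m i.
Proof. unfold pid; cbn. now rewrite map_params_upn. Qed.

Lemma lift_abs_pid (m i d : nat) : lift_abs m d (pid m i) = pid m i.
Proof.
  rewrite lift_abs_fsubst. unfold pid; cbn. f_equal.
  transitivity (map (subst_term TVar) (params m)); [|apply map_subst_term_id].
  apply map_params_ext. intros k Hk. unfold lift_index. now case_index.
Qed.

Lemma inst_abs_pid (i : nat) (ts : list term) : inst_abs (pid (length ts) i) ts = PVar i ts.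
Proof. unfold inst_abs, pid; cbn. f_equal. apply map_params_app_env. Qed.

Lemma fsubst_ren_pr (s : nat -> term) (rho : nat -> nat -> nat) (A : formula) :
  fsubst s (ren_pr rho A) = ren_pr rho (fsubst s A).
Proof.
  revert s rho; induction A; intros; cbn; rewrite ?length_map; f_equal; auto.
Qed.

Lemma upren_pr_comp (n : nat) (r1 r2 : nat -> nat -> nat) :
  (fun m i => upren_pr n r2 m (upren_pr n r1 m i)) = upren_pr n (fun m i => r2 m (r1 m i)).
Proof.
  extensionality m; extensionality i. unfold upren_pr.
  destruct (m =? n); [destruct i|]; reflexivity.
Qed.

Lemma ren_pr_comp (r1 r2 : nat -> nat -> nat) (A : formula) :
  ren_pr r2 (ren_pr r1 A) = ren_pr (fun m i => r2 m (r1 m i)) A.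
Proof.
  revert r1 r2; induction A; intros; cbn; f_equal; auto;
    rewrite IHA; f_equal; apply upren_pr_comp.
Qed.

Lemma ren_pr_pid (r : nat -> nat -> nat) (m i : nat) : ren_pr r (pid m i) = pid m (r m i).
Proof. unfold pid; cbn. now rewrite length_params. Qed.

Definition lift_env (n : nat) (tau : nat -> nat -> formula) : nat -> nat -> formula :=
  fun m i => lift_abs m n (tau m i).

Lemma subst_form_all1 s tau A :
  subst_form s tau (All1 A) = All1 (subst_form (upn 1 s) (lift_env 1 tau) A).
Proof. reflexivity. Qed.

Lemma subst_form_mu s tau D ts :
  subst_form s tau (Mu D ts) =
  Mu (subst_form (upn (length ts) s) (lift_env (length ts) (up_pr (length ts) tau)) D)
     (map (subst_term s) ts).
Proof. reflexivity. Qed.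

Lemma fsubst_all1 s A : fsubst s (All1 A) = All1 (fsubst (upn 1 s) A).
Proof. reflexivity. Qed.

Lemma up_pr_pid (n : nat) : up_pr n pid = pid.
Proof.
  extensionality m; extensionality i. unfold up_pr.
  destruct (Nat.eqb_spec m n); [destruct i; [reflexivity|]|];
    rewrite ren_pr_pid; unfold shift_pr; case_index; reflexivity.
Qed.

Lemma lift_env_pid (n : nat) : lift_env n pid = pid.
Proof. extensionality m; extensionality i. apply lift_abs_pid. Qed.

Lemma subst_form_pid (s : nat -> term) (A : formula) : subst_form s pid A = fsubst s A.
Proof.
  revert s; induction A; intro s.
  - reflexivity.
  - cbn. rewrite <- (length_map (subst_term s)). apply inst_abs_pid.
  - reflexivity.
  - cbn. now rewrite IHA1, IHA2.
  - rewrite subst_form_all1, lift_env_pid. now rewrite IHA.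
  - cbn. now rewrite up_pr_pid, IHA.
  - rewrite subst_form_mu, up_pr_pid, lift_env_pid. now rewrite IHA.
Qed.

Lemma lift_upn (m n : nat) (s : nat -> term) (G : formula) :
  fsubst (upn m (upn n s)) (lift_abs m n G) = lift_abs m n (fsubst (upn m s) G).
Proof.
  rewrite !lift_abs_fsubst, !fsubst_comp. f_equal. extensionality k.
  unfold lift_index. sigma; [reflexivity|].
  replace (k + n - m - n) with (k - m) by lia.
  f_equal. extensionality i. sigma. f_equal. lia.
Qed.

Lemma up_pr_fsubst (n : nat) (s : nat -> term) (tau : nat -> nat -> formula) :
  (fun m i => fsubst (upn m s) (up_pr n tau m i)) =
  up_pr n (fun m i => fsubst (upn m s) (tau m i)).
Proof.
  extensionality m; extensionality i. unfold up_pr.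
  destruct (m =? n); [destruct i|]; auto using pid_fsubst, fsubst_ren_pr.
Qed.

Lemma lift_env_fsubst (n : nat) (s : nat -> term) (tau : nat -> nat -> formula) :
  (fun m i => fsubst (upn m (upn n s)) (lift_env n tau m i)) =
  lift_env n (fun m i => fsubst (upn m s) (tau m i)).
Proof. extensionality m; extensionality i. apply lift_upn. Qed.

Lemma fsubst_subst_form (s1 s2 : nat -> term) (tau : nat -> nat -> formula) (A : formula) :
  fsubst s2 (subst_form s1 tau A) =
  subst_form (fun k => subst_term s2 (s1 k)) (fun m i => fsubst (upn m s2) (tau m i)) A.
Proof.
  revert s1 s2 tau; induction A; intros s1 s2 tau.
  - reflexivity.
  - cbn. unfold inst_abs. rewrite !fsubst_comp, !args_subst_app_env, app_env_subst,
      map_subst_term_comp.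
    rewrite upn_app_env by now rewrite length_map.
    do 2 f_equal. extensionality k. now rewrite subst_term_id.
  - cbn. now rewrite map_subst_term_comp.
  - cbn. now rewrite IHA1, IHA2.
  - rewrite !subst_form_all1, fsubst_all1, IHA, upn_comp, lift_env_fsubst. reflexivity.
  - cbn. now rewrite IHA, up_pr_fsubst.
  - rewrite !subst_form_mu. cbn.
    rewrite length_map, IHA, upn_comp, lift_env_fsubst, up_pr_fsubst, map_subst_term_comp.
    reflexivity.
Qed.

Lemma subst_form_fsubst (s1 s2 : nat -> term) (tau : nat -> nat -> formula) (A : formula) :
  subst_form s2 tau (fsubst s1 A) = subst_form (fun k => subst_term s2 (s1 k)) tau A.
Proof.
  revert s1 s2 tau; induction A; intros s1 s2 tau; rewrite ?fsubst_all1, ?subst_form_all1;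
    cbn [fsubst]; rewrite ?subst_form_mu; cbn [subst_form];
    rewrite ?map_subst_term_comp, ?length_map; f_equal; auto.
  - now rewrite IHA, upn_comp.
  - now rewrite IHA, upn_comp.
Qed.

Lemma lift_env_ren_pr (n : nat) (r : nat -> nat -> nat) (tau : nat -> nat -> formula) :
  lift_env n (fun m i => ren_pr r (tau m i)) = fun m i => ren_pr r (lift_env n tau m i).
Proof.
  extensionality m; extensionality i. unfold lift_env.
  rewrite !lift_abs_fsubst. apply fsubst_ren_pr.
Qed.

Lemma subst_form_ren_pr (s : nat -> term) (tau : nat -> nat -> formula)
    (r : nat -> nat -> nat) (A : formula) :
  subst_form s tau (ren_pr r A) = subst_form s (fun m i => tau m (r m i)) A.
Proof.
  assert (Hup : forall n tau r,
    (fun m i => up_pr n tau m (upren_pr n r m i)) = up_pr n (fun m i => tau m (r m i))).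
  { intros. extensionality m; extensionality i. unfold up_pr, upren_pr.
    destruct (m =? n); [destruct i|]; reflexivity. }
  revert s tau r; induction A; intros; cbn [ren_pr]; rewrite ?subst_form_all1, ?subst_form_mu;
    cbn [subst_form]; f_equal; auto.
  - now rewrite IHA.
  - now rewrite IHA, Hup.
  - rewrite IHA. f_equal. exact (f_equal (lift_env _) (Hup _ _ _)).
Qed.

Lemma up_pr_ren_pr (n : nat) (r : nat -> nat -> nat) (tau : nat -> nat -> formula) :
  (fun m i => ren_pr (upren_pr n r) (up_pr n tau m i)) =
  up_pr n (fun m i => ren_pr r (tau m i)).
Proof.
  extensionality m; extensionality i.
  assert (H : forall A, ren_pr (upren_pr n r) (ren_pr (shift_pr n) A) =
                        ren_pr (shift_pr n) (ren_pr r A)).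
  { intro A. rewrite !ren_pr_comp. f_equal. extensionality p; extensionality q.
    unfold upren_pr, shift_pr. destruct (p =? n); reflexivity. }
  unfold up_pr at 1 2. destruct (Nat.eqb_spec m n); [destruct i|]; auto.
  rewrite ren_pr_pid. unfold upren_pr. subst. now rewrite Nat.eqb_refl.
Qed.

Lemma ren_pr_subst_form (s : nat -> term) (tau : nat -> nat -> formula)
    (r : nat -> nat -> nat) (A : formula) :
  ren_pr r (subst_form s tau A) = subst_form s (fun m i => ren_pr r (tau m i)) A.
Proof.
  revert s tau r; induction A; intros; rewrite ?subst_form_all1, ?subst_form_mu;
    cbn [ren_pr subst_form]; rewrite ?length_map; f_equal; auto.
  - unfold inst_abs. now rewrite <- fsubst_ren_pr.
  - now rewrite IHA, lift_env_ren_pr.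
  - now rewrite IHA, up_pr_ren_pr.
  - now rewrite IHA, <- lift_env_ren_pr, up_pr_ren_pr.
Qed.

(** Predicate part of the composite of two substitutions: an abstraction of arity [m] is substituted
    under its own [m] parameters, so [s] and [tau] are lifted past them. *)
Definition comp_env (s : nat -> term) (tau tau1 : nat -> nat -> formula) :
    nat -> nat -> formula :=
  fun m i => subst_form (upn m s) (lift_env m tau) (tau1 m i).

Lemma lift_args_cancel (m n : nat) (ts : list term) (G : formula) : length ts = n ->
  fsubst (upn m (app_env ts TVar)) (lift_abs m n G) = G.
Proof.
  intro H. rewrite lift_abs_fsubst, fsubst_comp. rewrite <- (fsubst_id G) at 2. f_equal.
  extensionality k. unfold lift_index. sigma; f_equal; lia.
Qed.

Lemma lift_index_upn (m n : nat) (s : nat -> term) :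
  (fun k => subst_term (upn m (upn n s)) (lift_index m n k)) =
  (fun k => subst_term (lift_index m n) (upn m s k)).
Proof.
  extensionality k. unfold lift_index. sigma; [reflexivity|].
  replace (k + n - m - n) with (k - m) by lia.
  f_equal. extensionality i. sigma. f_equal. lia.
Qed.

Lemma lift_env_lift (m n : nat) (tau : nat -> nat -> formula) :
  lift_env m (lift_env n tau) =
  fun m' i => fsubst (upn m' (lift_index m n)) (lift_env m tau m' i).
Proof.
  extensionality p; extensionality i. unfold lift_env.
  rewrite !lift_abs_fsubst, !fsubst_comp. f_equal.
  extensionality k. unfold lift_index. sigma; f_equal; lia.
Qed.

Lemma comp_env_lift (n : nat) (s : nat -> term) (tau tau1 : nat -> nat -> formula) :
  comp_env (upn n s) (lift_env n tau) (lift_env n tau1) = lift_env n (comp_env s tau tau1).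
Proof.
  extensionality m; extensionality i. unfold comp_env.
  unfold lift_env at 3 4. rewrite !lift_abs_fsubst.
  rewrite subst_form_fsubst, fsubst_subst_form. f_equal.
  - apply lift_index_upn.
  - apply lift_env_lift.
Qed.

Lemma lift_inst_pid (m i : nat) (s : nat -> term) (tau : nat -> nat -> formula) :
  subst_form (upn m s) (lift_env m tau) (pid m i) = tau m i.
Proof.
  unfold pid, lift_env; cbn. rewrite length_params, map_params_upn.
  unfold inst_abs. rewrite args_subst_app_env, lift_abs_fsubst, fsubst_comp.
  rewrite <- (fsubst_id (tau m i)) at 2. f_equal. extensionality k.
  unfold lift_index. cbn [subst_term]. rewrite app_env_params.
  destruct (Nat.ltb_spec k m); case_index; f_equal; lia.
Qed.

Lemma comp_env_up (n : nat) (s : nat -> term) (tau tau1 : nat -> nat -> formula) :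
  comp_env s (up_pr n tau) (up_pr n tau1) = up_pr n (comp_env s tau tau1).
Proof.
  assert (H : forall m A, subst_form (upn m s) (lift_env m (up_pr n tau)) (ren_pr (shift_pr n) A)
              = ren_pr (shift_pr n) (subst_form (upn m s) (lift_env m tau) A)).
  { intros m A. rewrite subst_form_ren_pr, ren_pr_subst_form. f_equal.
    rewrite <- lift_env_ren_pr. unfold lift_env. extensionality p; extensionality q.
    f_equal. unfold up_pr, shift_pr. destruct (p =? n); reflexivity. }
  extensionality m; extensionality i. unfold comp_env.
  unfold up_pr at 2 3. destruct (Nat.eqb_spec m n); [destruct i|]; auto.
  rewrite lift_inst_pid. unfold up_pr. subst. now rewrite Nat.eqb_refl.
Qed.

(** Only the atomic case is not structural: there the parameters introduced by [comp_env] cancel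
    against the arguments. The laws [pren_comp], [pren_inst], [inst2_subst_form] and
    [unfold_mu_subst_form] rest on this one. *)
Lemma subst_form_comp (s1 s2 : nat -> term) (tau1 tau2 : nat -> nat -> formula) (A : formula) :
  subst_form s2 tau2 (subst_form s1 tau1 A) =
  subst_form (fun k => subst_term s2 (s1 k)) (comp_env s2 tau2 tau1) A.
Proof.
  revert s1 s2 tau1 tau2; induction A; intros.
  - reflexivity.
  - cbn. unfold inst_abs. rewrite subst_form_fsubst. unfold comp_env.
    rewrite fsubst_subst_form, !args_subst_app_env. f_equal.
    + rewrite upn_app_env by now rewrite length_map.
      rewrite app_env_subst, map_subst_term_comp. f_equal.
      extensionality k. now rewrite subst_term_id.
    + extensionality m; extensionality i. unfold lift_env.
      now rewrite lift_args_cancel by now rewrite length_map.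
  - cbn. now rewrite map_subst_term_comp.
  - cbn. now rewrite IHA1, IHA2.
  - now rewrite !subst_form_all1, IHA, upn_comp, comp_env_lift.
  - cbn. now rewrite IHA, comp_env_up.
  - rewrite !subst_form_mu, length_map, IHA, upn_comp, comp_env_lift, comp_env_up,
      map_subst_term_comp. reflexivity.
Qed.

(** * Occurrences and their signs under substitution *)

Lemma has_occ_fsubst (m i : nat) (b : bool) (s : nat -> term) (A : formula) :
  has_occ m i b (fsubst s A) = has_occ m i b A.
Proof.
  revert i b s; induction A; intros; cbn; rewrite ?length_map; auto.
  now rewrite IHA1, IHA2.
Qed.

Lemma has_occ_pid (m j n i : nat) (b : bool) :
  has_occ m j b (pid n i) = b && (i =? j) && (n =? m).
Proof. unfold pid; cbn. now rewrite length_params. Qed.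

Lemma has_occ_ren_pr (m i j : nat) (b : bool) (r : nat -> nat -> nat) (A : formula) :
  (forall k, r m k = j <-> k = i) ->
  has_occ m j b (ren_pr r A) = has_occ m i b A.
Proof.
  assert (Hup : forall n m i j r, (forall k, r m k = j <-> k = i) ->
    forall k, upren_pr n r m k = (if n =? m then S j else j) <-> k = (if n =? m then S i else i)).
  { clear. intros n m i j r H k. unfold upren_pr. rewrite (Nat.eqb_sym m n).
    destruct (n =? m); [|apply H].
    destruct k; cbn; [lia|]. specialize (H k). lia. }
  revert i j b r; induction A; intros i j b r H; cbn; auto.
  - destruct (Nat.eqb_spec (length l) m); [subst|now rewrite !andb_false_r].
    do 2 f_equal. apply eq_true_iff_eq. rewrite !Nat.eqb_eq. apply H.
  - now rewrite (IHA1 _ _ _ _ H), (IHA2 _ _ _ _ H).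
Qed.

Lemma has_occ_ren_pr_fresh (m j : nat) (b : bool) (r : nat -> nat -> nat) (A : formula) :
  (forall k, r m k <> j) -> has_occ m j b (ren_pr r A) = false.
Proof.
  assert (Hup : forall n m j r, (forall k, r m k <> j) ->
    forall k, upren_pr n r m k <> (if n =? m then S j else j)).
  { clear. intros n m j r H k. unfold upren_pr. rewrite (Nat.eqb_sym m n).
    destruct (n =? m); [|apply H]. destruct k; cbn; [lia|]. specialize (H k). lia. }
  revert j b r; induction A; intros j b r H; cbn; auto.
  - destruct (Nat.eqb_spec (length l) m); [subst|now rewrite !andb_false_r].
    destruct (Nat.eqb_spec (r (length l) n) j); [now apply H in e|]. now rewrite andb_false_r.
  - now rewrite (IHA1 _ _ _ H), (IHA2 _ _ _ H).
Qed.

Lemma has_occ_shift_pr (n m i : nat) (b : bool) (A : formula) :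
  has_occ m (if n =? m then S i else i) b (ren_pr (shift_pr n) A) = has_occ m i b A.
Proof.
  apply has_occ_ren_pr. intro k. unfold shift_pr. rewrite (Nat.eqb_sym m n).
  destruct (n =? m); lia.
Qed.

Lemma has_occ_shift_pr_0 (n : nat) (b : bool) (A : formula) :
  has_occ n 0 b (ren_pr (shift_pr n) A) = false.
Proof.
  apply has_occ_ren_pr_fresh. intro k. unfold shift_pr. now rewrite Nat.eqb_refl.
Qed.

(* Under [tau], exactly the occurrences of the variable [(m, i)] become occurrences of [(m, j)]. *)
Definition tracks (m i j : nat) (tau : nat -> nat -> formula) : Prop :=
  forall m' i' b, has_occ m j b (tau m' i') = b && (i' =? i) && (m' =? m).

Lemma tracks_lift_env (m i j n : nat) (tau : nat -> nat -> formula) :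
  tracks m i j tau -> tracks m i j (lift_env n tau).
Proof.
  intros H m' i' b. unfold lift_env. now rewrite lift_abs_fsubst, has_occ_fsubst.
Qed.

Lemma tracks_up_pr (m i j n : nat) (tau : nat -> nat -> formula) :
  tracks m i j tau ->
  tracks m (if n =? m then S i else i) (if n =? m then S j else j) (up_pr n tau).
Proof.
  intros H m' i' b. unfold up_pr. destruct (Nat.eqb_spec m' n) as [->|Hn].
  - destruct i' as [|i'].
    + rewrite has_occ_pid. destruct (Nat.eqb_spec n m); [reflexivity|].
      now rewrite !andb_false_r.
    + rewrite has_occ_shift_pr, H. destruct (Nat.eqb_spec n m); [reflexivity|].
      now rewrite !andb_false_r.
  - rewrite has_occ_shift_pr, H. destruct (Nat.eqb_spec n m); [|reflexivity].
    subst. apply Nat.eqb_neq in Hn. now rewrite Hn, !andb_false_r.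
Qed.

(** Whatever [tau] is, the bound variable goes to itself and no other image mentions it. Hence the
    side conditions on [Mu] and on negative [All2] survive every substitution. *)
Lemma tracks_up_pr_0 (n : nat) (tau : nat -> nat -> formula) : tracks n 0 0 (up_pr n tau).
Proof.
  intros m' i' b. unfold up_pr. destruct (Nat.eqb_spec m' n) as [->|Hn].
  - destruct i' as [|i'].
    + rewrite has_occ_pid, !Nat.eqb_refl. reflexivity.
    + now rewrite has_occ_shift_pr_0, andb_false_r.
  - now rewrite has_occ_shift_pr_0, andb_false_r.
Qed.

Lemma has_occ_subst_form (m i j : nat) (b : bool) (s : nat -> term)
    (tau : nat -> nat -> formula) (A : formula) :
  tracks m i j tau -> has_occ m j b (subst_form s tau A) = has_occ m i b A.
Proof.
  revert i j b s tau; induction A; intros i j b s tau H;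
    rewrite ?subst_form_all1, ?subst_form_mu; cbn; rewrite ?length_map; auto.
  - unfold inst_abs. now rewrite has_occ_fsubst, H.
  - now rewrite (IHA1 _ _ _ _ _ H), (IHA2 _ _ _ _ _ H).
  - apply IHA. now apply tracks_lift_env.
  - apply IHA. now apply tracks_up_pr.
  - apply IHA. now apply tracks_lift_env, tracks_up_pr.
Qed.

Lemma occurs_subst_form (m i j : nat) (s : nat -> term) (tau : nat -> nat -> formula)
    (A : formula) :
  tracks m i j tau -> occurs m j (subst_form s tau A) = occurs m i A.
Proof. intro H. unfold occurs. now rewrite !(has_occ_subst_form m i j) by assumption. Qed.

Lemma positive_subst_form (m i j : nat) (s : nat -> term) (tau : nat -> nat -> formula)
    (A : formula) :
  tracks m i j tau -> positive m j (subst_form s tau A) = positive m i A.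
Proof. intro H. unfold positive. now rewrite !(has_occ_subst_form m i j) by assumption. Qed.

Lemma occurs_fsubst (m i : nat) (s : nat -> term) (A : formula) :
  occurs m i (fsubst s A) = occurs m i A.
Proof. unfold occurs. now rewrite !has_occ_fsubst. Qed.

Lemma positive_fsubst (m i : nat) (s : nat -> term) (A : formula) :
  positive m i (fsubst s A) = positive m i A.
Proof. unfold positive. now rewrite !has_occ_fsubst. Qed.

Lemma upren_pr_0 (n : nat) (r : nat -> nat -> nat) (k : nat) : upren_pr n r n k = 0 <-> k = 0.
Proof. unfold upren_pr. rewrite Nat.eqb_refl. destruct k; cbn; lia. Qed.

Lemma occurs_upren_pr_0 (n : nat) (r : nat -> nat -> nat) (A : formula) :
  occurs n 0 (ren_pr (upren_pr n r) A) = occurs n 0 A.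
Proof. unfold occurs. now rewrite !(has_occ_ren_pr n 0 0) by apply upren_pr_0. Qed.

Lemma positive_upren_pr_0 (n : nat) (r : nat -> nat -> nat) (A : formula) :
  positive n 0 (ren_pr (upren_pr n r) A) = positive n 0 A.
Proof. unfold positive. now rewrite !(has_occ_ren_pr n 0 0) by apply upren_pr_0. Qed.

(** * Well-formedness under substitution *)

Lemma wf_fsubst (s : nat -> term) (A : formula) : wf A -> wf (fsubst s A).
Proof.
  revert s; induction A; cbn; intros s H; auto.
  - now destruct H; split; auto.
  - rewrite length_map, occurs_fsubst, positive_fsubst. intuition.
Qed.

Lemma wf_fsubst_inv (s : nat -> term) (A : formula) : wf (fsubst s A) -> wf A.
Proof.
  revert s; induction A; cbn; intros s H; eauto.
  - destruct H; split; eauto.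
  - rewrite length_map, occurs_fsubst, positive_fsubst in H. intuition eauto.
Qed.

Lemma wf_ren_pr (r : nat -> nat -> nat) (A : formula) : wf A -> wf (ren_pr r A).
Proof.
  revert r; induction A; cbn; intros r H; auto.
  - now destruct H; split; auto.
  - rewrite occurs_upren_pr_0, positive_upren_pr_0. intuition.
Qed.

Lemma wf_subst_form (s : nat -> term) (tau : nat -> nat -> formula) (A : formula) :
  wf A -> (forall m i, wf (tau m i)) -> wf (subst_form s tau A).
Proof.
  assert (Hup : forall n tau, (forall m i, wf (tau m i)) -> forall m i, wf (up_pr n tau m i)).
  { intros n t H m i. unfold up_pr. destruct (m =? n); [destruct i|]; auto using wf_ren_pr.
    exact I. }
  assert (Hl : forall n tau, (forall m i, wf (tau m i)) -> forall m i, wf (lift_env n tau m i)).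
  { intros n t H m i. unfold lift_env. rewrite lift_abs_fsubst. now apply wf_fsubst. }
  revert s tau; induction A; intros s tau H Ht; rewrite ?subst_form_all1, ?subst_form_mu; cbn;
    auto.
  - apply wf_fsubst, Ht.
  - destruct H; split; auto.
  - rewrite length_map. destruct H as (Ho & Hp & H). repeat split.
    + rewrite <- Ho. apply occurs_subst_form, tracks_lift_env, tracks_up_pr_0.
    + rewrite <- Hp. apply positive_subst_form, tracks_lift_env, tracks_up_pr_0.
    + apply IHA; auto.
Qed.

(* Stability of the classes of positive and negative types *)
Scheme Omega_pos_mut := Induction for Omega_pos Sort Prop
with Omega_neg_mut := Induction for Omega_neg Sort Prop.
Combined Scheme Omega_ind from Omega_pos_mut, Omega_neg_mut.

Lemma wf_Omega : (forall A, Omega_pos A -> wf A) /\ (forall A, Omega_neg A -> wf A).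
Proof. apply Omega_ind; cbn; auto. Qed.

Lemma wf_Omega_pos (A : formula) : Omega_pos A -> wf A.
Proof. apply wf_Omega. Qed.

Lemma wf_Omega_neg (A : formula) : Omega_neg A -> wf A.
Proof. apply wf_Omega. Qed.

Lemma Omega_fsubst :
  (forall A, Omega_pos A -> forall s, Omega_pos (fsubst s A)) /\
  (forall A, Omega_neg A -> forall s, Omega_neg (fsubst s A)).
Proof.
  apply Omega_ind; intros; cbn; try (constructor; auto; fail).
  - constructor; rewrite ?length_map, ?occurs_fsubst, ?positive_fsubst; auto.
  - constructor; rewrite ?occurs_fsubst; auto.
Qed.

Lemma Omega_ren_pr :
  (forall A, Omega_pos A -> forall r, Omega_pos (ren_pr r A)) /\
  (forall A, Omega_neg A -> forall r, Omega_neg (ren_pr r A)).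
Proof.
  apply Omega_ind; intros; cbn; try (constructor; auto; fail).
  - constructor; rewrite ?occurs_upren_pr_0, ?positive_upren_pr_0; auto.
  - constructor; rewrite ?occurs_upren_pr_0; auto.
Qed.

Definition Omega (b : bool) : formula -> Prop := if b then Omega_pos else Omega_neg.

Lemma Omega_pid (b : bool) (m i : nat) : Omega b (pid m i).
Proof. destruct b; constructor. Qed.

Lemma Omega_any_fsubst (b : bool) (s : nat -> term) (A : formula) :
  Omega b A -> Omega b (fsubst s A).
Proof. destruct b; intro H; now apply Omega_fsubst. Qed.

Lemma Omega_any_ren_pr (b : bool) (r : nat -> nat -> nat) (A : formula) :
  Omega b A -> Omega b (ren_pr r A).
Proof. destruct b; intro H; now apply Omega_ren_pr. Qed.

(* [b] is the sign of the class of the formula in which the substitution takes place. *)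
Definition Omega_env (b : bool) (A : formula) (tau : nat -> nat -> formula) : Prop :=
  forall m i c, has_occ m i c A = true -> Omega (Bool.eqb c b) (tau m i).

Lemma Omega_env_up (b : bool) (n : nat) (A : formula) (tau : nat -> nat -> formula) :
  (forall m i c, has_occ m (if n =? m then S i else i) c A = true ->
     Omega (Bool.eqb c b) (tau m i)) ->
  Omega_env b A (up_pr n tau).
Proof.
  intros H m i c Ho. unfold up_pr. specialize (H m). rewrite Nat.eqb_sym in H.
  destruct (m =? n); [destruct i|]; auto using Omega_pid, Omega_any_ren_pr.
Qed.

Lemma Omega_env_lift (b : bool) (n : nat) (A : formula) (tau : nat -> nat -> formula) :
  Omega_env b A tau -> Omega_env b A (lift_env n tau).
Proof.
  intros H m i c Ho. unfold lift_env. rewrite lift_abs_fsubst.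
  now apply Omega_any_fsubst, H.
Qed.

(** On the left of an arrow the sign of an occurrence and the sign of the class flip together, so
    their comparison is unchanged. *)
Lemma Omega_env_imp_l (b : bool) (A B : formula) (tau : nat -> nat -> formula) :
  Omega_env b (Imp A B) tau -> Omega_env (negb b) A tau.
Proof.
  intros H m i c Ho. replace (Bool.eqb c (negb b)) with (Bool.eqb (negb c) b)
    by now destruct c, b.
  apply H. cbn. now rewrite negb_involutive, Ho.
Qed.

Lemma Omega_env_imp_r (b : bool) (A B : formula) (tau : nat -> nat -> formula) :
  Omega_env b (Imp A B) tau -> Omega_env b B tau.
Proof. intros H m i c Ho. apply H. cbn. now rewrite Ho, orb_true_r. Qed.

(** A positive occurrence receives an abstraction of the same class as the surrounding formula, a
    negative one an abstraction of the opposite class. Bound variables are tracked, so the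
    conditions at [Mu] and [All2] persist. *)
Lemma Omega_subst_form :
  (forall A, Omega_pos A -> forall s tau, Omega_env true A tau ->
     Omega_pos (subst_form s tau A)) /\
  (forall A, Omega_neg A -> forall s tau, Omega_env false A tau ->
     Omega_neg (subst_form s tau A)).
Proof.
  apply Omega_ind; intros; rewrite ?subst_form_all1, ?subst_form_mu; cbn [subst_form];
    try (constructor; eauto using Omega_env_lift; fail).
  - apply (Omega_any_fsubst true), (H (length args) i true).
    cbn. now rewrite !Nat.eqb_refl.
  - constructor; [apply H, (Omega_env_imp_l true _ _ _ H1) | apply H0, (Omega_env_imp_r _ _ _ _ H1)].
  - constructor. apply H. now apply Omega_env_up.
  - constructor; rewrite ?length_map.
    + rewrite <- e. apply occurs_subst_form, tracks_lift_env, tracks_up_pr_0.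
    + rewrite <- e0. apply positive_subst_form, tracks_lift_env, tracks_up_pr_0.
    + apply H. apply Omega_env_lift. now apply Omega_env_up.
  - apply (Omega_any_fsubst false), (H (length args) i true).
    cbn. now rewrite !Nat.eqb_refl.
  - constructor; [apply H, (Omega_env_imp_l false _ _ _ H1) | apply H0, (Omega_env_imp_r _ _ _ _ H1)].
  - constructor.
    + rewrite <- e. apply occurs_subst_form, tracks_up_pr_0.
    + apply H. now apply Omega_env_up.
Qed.

(** * Renamings *)

Definition ren_env (r : nat -> nat -> nat) : nat -> nat -> formula := fun m i => pid m (r m i).

(** Arbitrary terms replace first-order variables, but only variables replace predicate variables.
    Restricted subtyping is stable under this kind of substitution; a general abstraction could turn
    a restricted instance into an arbitrary formula. *)
Definition pren (s : nat -> term) (r : nat -> nat -> nat) : formula -> formula :=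
  subst_form s (ren_env r).

Lemma lift_env_ren_env (n : nat) (r : nat -> nat -> nat) : lift_env n (ren_env r) = ren_env r.
Proof. extensionality m; extensionality i. apply lift_abs_pid. Qed.

Lemma up_pr_ren_env (n : nat) (r : nat -> nat -> nat) :
  up_pr n (ren_env r) = ren_env (upren_pr n r).
Proof.
  extensionality m; extensionality i. unfold up_pr, ren_env, upren_pr.
  destruct (Nat.eqb_spec m n); [destruct i; [reflexivity|]|];
    rewrite ren_pr_pid; unfold shift_pr; case_index; reflexivity.
Qed.

Lemma pren_all1 s r A : pren s r (All1 A) = All1 (pren (upn 1 s) r A).
Proof. unfold pren. now rewrite subst_form_all1, lift_env_ren_env. Qed.

Lemma pren_all2 s r n A : pren s r (All2 n A) = All2 n (pren s (upren_pr n r) A).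
Proof. unfold pren. cbn. now rewrite up_pr_ren_env. Qed.

Lemma pren_mu s r D ts :
  pren s r (Mu D ts) =
  Mu (pren (upn (length ts) s) (upren_pr (length ts) r) D) (map (subst_term s) ts).
Proof. unfold pren. now rewrite subst_form_mu, up_pr_ren_env, lift_env_ren_env. Qed.

Lemma pren_pvar s r i ts : pren s r (PVar i ts) = PVar (r (length ts) i) (map (subst_term s) ts).
Proof.
  unfold pren; cbn. unfold ren_env. generalize (r (length ts) i) as j. intro j.
  rewrite <- (length_map (subst_term s) ts). apply inst_abs_pid.
Qed.

Lemma wf_pren (s : nat -> term) (r : nat -> nat -> nat) (A : formula) : wf A -> wf (pren s r A).
Proof. intro H. apply wf_subst_form; [assumption|]. intros; exact I. Qed.

Lemma Omega_pren (b : bool) (s : nat -> term) (r : nat -> nat -> nat) (A : formula) :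
  Omega b A -> Omega b (pren s r A).
Proof.
  destruct b; intro H; apply Omega_subst_form; auto; intros ? ? ? _; apply Omega_pid.
Qed.

Lemma ren_pr_pren (r : nat -> nat -> nat) (A : formula) : ren_pr r A = pren TVar r A.
Proof.
  rewrite <- (fsubst_id A) at 1. rewrite <- subst_form_pid, ren_pr_subst_form.
  unfold pren. f_equal. extensionality m; extensionality i. apply ren_pr_pid.
Qed.

Lemma fsubst_pren (s : nat -> term) (A : formula) : fsubst s A = pren s (fun _ i => i) A.
Proof. symmetry. apply subst_form_pid. Qed.

Lemma pren_fsubst (s1 s2 : nat -> term) (r : nat -> nat -> nat) (A : formula) :
  pren s2 r (fsubst s1 A) = pren (fun k => subst_term s2 (s1 k)) r A.
Proof. apply subst_form_fsubst. Qed.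

Lemma fsubst_ren_env (s : nat -> term) (r : nat -> nat -> nat) :
  (fun m i => fsubst (upn m s) (ren_env r m i)) = ren_env r.
Proof. extensionality p; extensionality i. apply pid_fsubst. Qed.

Lemma fsubst_pren_comp (s1 s2 : nat -> term) (r : nat -> nat -> nat) (A : formula) :
  fsubst s2 (pren s1 r A) = pren (fun k => subst_term s2 (s1 k)) r A.
Proof. unfold pren. now rewrite fsubst_subst_form, fsubst_ren_env. Qed.

Lemma comp_env_ren_env (s : nat -> term) (tau : nat -> nat -> formula) (r : nat -> nat -> nat) :
  comp_env s tau (ren_env r) = fun m i => tau m (r m i).
Proof. extensionality m; extensionality i. apply lift_inst_pid. Qed.

Lemma pren_comp (s1 s2 : nat -> term) (r1 r2 : nat -> nat -> nat) (A : formula) :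
  pren s2 r2 (pren s1 r1 A) =
  pren (fun k => subst_term s2 (s1 k)) (fun m i => r2 m (r1 m i)) A.
Proof. unfold pren. now rewrite subst_form_comp, comp_env_ren_env. Qed.

(** Polymorphic because it extends both syntactic substitutions and semantic environments. In
    contrast to [up_pr], nothing in the tail is shifted. *)
Definition pcons {T : Type} (n : nat) (x : T) (f : nat -> nat -> T) : nat -> nat -> T :=
  fun m i => if m =? n then match i with 0 => x | S i' => f m i' end else f m i.

(** One law serves [inst2], [unfold_mu] and the induction rule. They differ in their first-order
    parts, whose compatibility is left as a hypothesis. *)
Lemma pren_inst (s s0 s1 s2 : nat -> term) (r : nat -> nat -> nat) (n : nat) (G D : formula) :
  (fun k => subst_term s (s0 k)) = (fun k => subst_term s2 (s1 k)) ->
  pren s r (subst_form s0 (pscons n G) D) =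
  subst_form s2 (pscons n (pren (upn n s) r G)) (pren s1 (upren_pr n r) D).
Proof.
  intro H. unfold pren. rewrite !subst_form_comp, comp_env_ren_env. f_equal; [assumption|].
  extensionality m; extensionality i. unfold comp_env, pscons, upren_pr.
  destruct (Nat.eqb_spec m n) as [->|]; [destruct i|].
  - now rewrite lift_env_ren_env.
  - now rewrite lift_inst_pid.
  - now rewrite lift_inst_pid.
Qed.

Lemma pren_lift_abs (n d : nat) (s : nat -> term) (r : nat -> nat -> nat) (G : formula) :
  pren (upn n (upn d s)) r (lift_abs n d G) = lift_abs n d (pren (upn n s) r G).
Proof. rewrite !lift_abs_fsubst, pren_fsubst, fsubst_pren_comp. f_equal. apply lift_index_upn. Qed.

Lemma pren_inst1 (s : nat -> term) (r : nat -> nat -> nat) (A : formula) (u : term) :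
  pren s r (inst1 A u) = inst1 (pren (upn 1 s) r A) (subst_term s u).
Proof.
  unfold inst1. rewrite pren_fsubst, fsubst_pren_comp. f_equal.
  extensionality k. destruct k as [|k]; [reflexivity|]. cbn.
  rewrite ren_term_subst, subst_term_comp. cbn. now rewrite subst_term_id.
Qed.

Lemma pren_inst2 (s : nat -> term) (r : nat -> nat -> nat) (n : nat) (A G : formula) :
  pren s r (inst2 n A G) = inst2 n (pren s (upren_pr n r) A) (pren (upn n s) r G).
Proof.
  unfold inst2. apply pren_inst. extensionality k. cbn. now rewrite subst_term_id.
Qed.

Lemma pren_shift1 (s : nat -> term) (r : nat -> nat -> nat) (A : formula) :
  pren (upn 1 s) r (shift1 A) = shift1 (pren s r A).
Proof.
  unfold shift1. rewrite !ren_fo_fsubst, pren_fsubst, fsubst_pren_comp. f_equal.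
  extensionality k. cbn. apply ren_term_subst.
Qed.

Lemma pren_shift2 (s : nat -> term) (r : nat -> nat -> nat) (n : nat) (A : formula) :
  pren s (upren_pr n r) (shift2 n A) = shift2 n (pren s r A).
Proof.
  unfold shift2. rewrite !ren_pr_pren, !pren_comp. f_equal.
  - extensionality k. cbn. now rewrite subst_term_id.
  - extensionality m; extensionality i. unfold upren_pr, shift_pr. now destruct (m =? n).
Qed.

Lemma pren_inst_abs (s : nat -> term) (r : nat -> nat -> nat) (G : formula) (ts : list term) :
  pren s r (inst_abs G ts) =
  inst_abs (pren (upn (length ts) s) r G) (map (subst_term s) ts).
Proof.
  unfold inst_abs. rewrite pren_fsubst, fsubst_pren_comp, !args_subst_app_env.
  rewrite app_env_subst, upn_app_env by now rewrite length_map.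
  do 2 f_equal. extensionality k. cbn. now rewrite subst_term_id.
Qed.

Lemma pren_unfold_mu (s : nat -> term) (r : nat -> nat -> nat) (D : formula) (ts : list term) :
  pren s r (unfold_mu D ts) =
  unfold_mu (pren (upn (length ts) s) (upren_pr (length ts) r) D) (map (subst_term s) ts).
Proof.
  unfold unfold_mu. rewrite length_map, !args_subst_app_env.
  rewrite (pren_inst s (app_env ts TVar) (upn (length ts) s) (app_env (map (subst_term s) ts) TVar)).
  - f_equal. f_equal. rewrite pren_mu, length_params, pren_lift_abs, map_params_upn. reflexivity.
  - rewrite app_env_subst, upn_app_env by now rewrite length_map.
    f_equal. extensionality k. cbn. now rewrite subst_term_id.
Qed.

Lemma eq_inst_subst (E : term -> term -> Prop) (s : nat -> term) (u v : term) :
  eq_inst E u v -> eq_inst E (subst_term s u) (subst_term s v).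
Proof.
  intros (l & r & s0 & H & -> & ->). exists l, r, (fun k => subst_term s (s0 k)).
  now rewrite !subst_term_comp.
Qed.

Lemma eq_inst_sym (E : term -> term -> Prop) (u v : term) : eq_inst E u v -> eq_inst E v u.
Proof. intros (l & r & s & H & Hu & Hv). exists r, l, s. tauto. Qed.

(** * Subtyping under renaming *)

Lemma sub_wf (r : bool) (E : term -> term -> Prop) (A B : formula) :
  sub r E A B -> wf A /\ wf B.
Proof. induction 1; tauto. Qed.

Lemma restricted_pren (n : nat) (s : nat -> term) (r : nat -> nat -> nat) (G : formula) :
  restricted n G -> restricted n (pren (upn n s) r G).
Proof.
  intros [[j ->] | [c ->]].
  - left. exists (r n j). now rewrite pren_pvar, length_params, map_params_upn.
  - right. exists c. cbn. now rewrite map_params_upn.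
Qed.

(** Every rule commutes with renaming, and the flag is kept: an instance that is a predicate
    variable or symbol remains one by [restricted_pren]. *)
Lemma sub_pren (b : bool) (E : term -> term -> Prop) (A B : formula) : sub b E A B ->
  forall s r, sub b E (pren s r A) (pren s r B).
Proof.
  induction 1; intros s0 r0.
  - apply s_refl. now apply wf_pren.
  - apply (wf_pren s0 r0) in H, H0. now apply s_arrow; [| |apply IHsub1|apply IHsub2].
  - apply (wf_pren s0 r0) in H. specialize (IHsub s0 r0).
    rewrite pren_all1 in *. rewrite pren_inst1 in IHsub. eapply s_all1_l; eauto using wf_pren.
  - apply (wf_pren s0 r0) in H. specialize (IHsub s0 r0).
    rewrite pren_all2 in *. rewrite pren_inst2 in IHsub.
    apply s_all2_l with (G := pren (upn n s0) r0 G); auto using wf_pren, restricted_pren.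
  - apply (wf_pren s0 r0) in H0. specialize (IHsub (upn 1 s0) r0).
    rewrite pren_all1 in *. rewrite pren_shift1 in IHsub. eapply s_all1_r; eauto using wf_pren.
  - apply (wf_pren s0 r0) in H0. specialize (IHsub s0 (upren_pr n r0)).
    rewrite pren_all2 in *. rewrite pren_shift2 in IHsub. eapply s_all2_r; eauto using wf_pren.
  - apply (wf_pren s0 r0) in H0. specialize (IHsub s0 r0).
    rewrite pren_inst1 in *. eapply s_eq; eauto using wf_pren, eq_inst_subst.
  - eapply s_trans; eauto using wf_pren.
  - apply (wf_pren s0 r0) in H, H0. rewrite pren_mu, pren_unfold_mu in *. now apply s_fold.
  - apply (wf_pren s0 r0) in H, H0. rewrite pren_mu, pren_unfold_mu in *. now apply s_unfold.
  - apply (wf_pren s0 r0) in H, H0.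
    specialize (IHsub (upn (length ts) s0) r0).
    rewrite pren_mu, pren_inst_abs in *.
    rewrite (pren_inst _ TVar (upn (length ts) s0) TVar) in IHsub.
    + rewrite pren_lift_abs in IHsub. apply s_ind; rewrite ?length_map; assumption.
    + extensionality k. cbn. now rewrite subst_term_id.
Qed.

(** * Bounds on indices, for the choice of fresh variables *)

Fixpoint term_bound (t : term) : nat :=
  match t with
  | TVar k => S k
  | TFun _ ts => list_max (map term_bound ts)
  end.

Definition terms_bound (ts : list term) : nat := list_max (map term_bound ts).

(** Bound indices are not discounted, and one number serves for first-order indices and for
    predicate indices of all arities. Such a coarse bound suffices to find a fresh index. *)
Fixpoint bound (A : formula) : nat :=
  match A with
  | Bot => 0
  | PVar i ts => Nat.max (S i) (terms_bound ts)
  | PSym _ ts => terms_bound ts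
  | Imp A B => Nat.max (bound A) (bound B)
  | All1 A | All2 _ A => bound A
  | Mu D ts => Nat.max (bound D) (terms_bound ts)
  end.

Lemma list_max_map_le {T : Type} (f : T -> nat) (l : list T) (b : nat) :
  list_max (map f l) <= b <-> Forall (fun x => f x <= b) l.
Proof. rewrite list_max_le, Forall_map. reflexivity. Qed.

Lemma subst_term_ext_bound (s s' : nat -> term) (b : nat) (t : term) :
  (forall k, k < b -> s k = s' k) -> term_bound t <= b -> subst_term s t = subst_term s' t.
Proof.
  intro H. induction t as [k | f ts IH] using term_nested_ind; cbn [term_bound subst_term]; intro Hb.
  - apply H. lia.
  - f_equal. apply map_ext_Forall.
    apply list_max_map_le in Hb. rewrite Forall_forall in *. auto.
Qed.

Lemma map_subst_term_ext_bound (s s' : nat -> term) (b : nat) (ts : list term) :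
  (forall k, k < b -> s k = s' k) -> terms_bound ts <= b ->
  map (subst_term s) ts = map (subst_term s') ts.
Proof.
  intros H Hb. apply map_ext_Forall.
  apply list_max_map_le in Hb. rewrite Forall_forall in *. eauto using subst_term_ext_bound.
Qed.

(** Under binders the lifted maps read the original ones only at smaller indices, so the same [b]
    can be carried through unchanged. *)
Lemma pren_ext_bound (s s' : nat -> term) (r r' : nat -> nat -> nat) (b : nat) (A : formula) :
  (forall k, k < b -> s k = s' k) -> (forall m k, k < b -> r m k = r' m k) ->
  bound A <= b -> pren s r A = pren s' r' A.
Proof.
  assert (Hs : forall n s s', (forall k, k < b -> s k = s' k) ->
    forall k, k < b -> upn n s k = upn n s' k).
  { clear. intros n s s' H k Hk. sigma; [reflexivity|]. now rewrite H by lia. }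
  assert (Hr : forall n r r', (forall m k, k < b -> r m k = r' m k) ->
    forall m k, k < b -> upren_pr n r m k = upren_pr n r' m k).
  { clear. intros n r r' H m k Hk. unfold upren_pr. destruct (m =? n); auto.
    destruct k; cbn; auto with arith. }
  revert s s' r r'; induction A; cbn [bound]; intros s s' r r' H1 H2 Hb;
    rewrite ?pren_all1, ?pren_all2, ?pren_mu, ?pren_pvar.
  - reflexivity.
  - rewrite H2 by lia. f_equal. apply (map_subst_term_ext_bound s s' b); [assumption|lia].
  - cbn. f_equal. now apply (map_subst_term_ext_bound s s' b).
  - change (Imp (pren s r A1) (pren s r A2) = Imp (pren s' r' A1) (pren s' r' A2)).
    f_equal; [apply IHA1|apply IHA2]; auto; lia.
  - f_equal. auto.
  - f_equal. auto.
  - f_equal; [apply IHA; auto; lia|].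
    apply (map_subst_term_ext_bound s s' b); [assumption|lia].
Qed.

Lemma pren_id (A : formula) : pren TVar (fun _ i => i) A = A.
Proof. rewrite <- fsubst_pren. apply fsubst_id. Qed.

(** * Restricted typing with its invariants *)

Definition Omega_ctx (G : ctx) : Prop := Forall (fun p => Omega_neg (snd p)) G.

(* Derivations of TTR_0 carrying the two invariants of the theorem: contexts are negative and
   arguments of applications have positive types. *)
Inductive styping (E : term -> term -> Prop) : ctx -> lterm -> formula -> Prop :=
| styping_ax G x A : Omega_ctx G -> lookup x G = Some A -> styping E G (LVar x) A
| styping_lam G x t A B : styping E ((x, A) :: G) t B -> styping E G (LLam x t) (Imp A B)
| styping_app G t u A B : Omega_pos A ->
    styping E G t (Imp A B) -> styping E G u A -> styping E G (LApp t u) B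
| styping_all1 G t A : Omega_ctx G -> styping E (shift1_ctx G) t A -> styping E G t (All1 A)
| styping_all2 G t n A : Omega_ctx G -> styping E (shift2_ctx n G) t A -> styping E G t (All2 n A)
| styping_sub G t A B : sub true E A B -> styping E G t A -> styping E G t B.

Lemma lookup_In (x : nat) (G : ctx) (A : formula) : lookup x G = Some A -> In (x, A) G.
Proof.
  induction G as [|[y B] G IH]; cbn; [discriminate|].
  destruct (Nat.eqb_spec x y); [intros [= ->]; subst|]; auto.
Qed.

Definition pren_ctx (s : nat -> term) (r : nat -> nat -> nat) (G : ctx) : ctx :=
  map (fun p => (fst p, pren s r (snd p))) G.

Lemma lookup_pren_ctx (x : nat) (G : ctx) (A : formula) s r :
  lookup x G = Some A -> lookup x (pren_ctx s r G) = Some (pren s r A).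
Proof.
  induction G as [|[y B] G IH]; cbn; [discriminate|].
  destruct (x =? y); [intros [= ->]|]; auto.
Qed.

Lemma shift1_pren (A : formula) : shift1 A = pren (fun k => TVar (S k)) (fun _ i => i) A.
Proof. unfold shift1. now rewrite ren_fo_fsubst, fsubst_pren. Qed.

Lemma shift2_pren (n : nat) (A : formula) : shift2 n A = pren TVar (shift_pr n) A.
Proof. apply ren_pr_pren. Qed.

Lemma shift1_ctx_pren (G : ctx) :
  shift1_ctx G = pren_ctx (fun k => TVar (S k)) (fun _ i => i) G.
Proof. apply map_ext. intros [x A]. cbn [fst snd]. now rewrite shift1_pren. Qed.

Lemma shift2_ctx_pren (n : nat) (G : ctx) : shift2_ctx n G = pren_ctx TVar (shift_pr n) G.
Proof. apply map_ext. intros [x A]. cbn [fst snd]. now rewrite shift2_pren. Qed.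

Lemma Omega_ctx_pren (s : nat -> term) (r : nat -> nat -> nat) (G : ctx) :
  Omega_ctx G -> Omega_ctx (pren_ctx s r G).
Proof.
  unfold Omega_ctx, pren_ctx. rewrite Forall_map. apply Forall_impl.
  intros [x A]. apply (Omega_pren false).
Qed.

Lemma styping_pren (E : term -> term -> Prop) (G : ctx) (t : lterm) (A : formula) :
  styping E G t A -> forall s r, styping E (pren_ctx s r G) t (pren s r A).
Proof.
  induction 1; intros s0 r0.
  - apply styping_ax; auto using Omega_ctx_pren, lookup_pren_ctx.
  - apply styping_lam. apply IHstyping.
  - eapply styping_app; [|apply IHstyping1|apply IHstyping2]. now apply (Omega_pren true).
  - rewrite pren_all1. apply styping_all1; [now apply Omega_ctx_pren|].
    specialize (IHstyping (upn 1 s0) r0).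
    replace (shift1_ctx (pren_ctx s0 r0 G)) with (pren_ctx (upn 1 s0) r0 (shift1_ctx G)); auto.
    unfold pren_ctx, shift1_ctx. rewrite !map_map. apply map_ext. intros [x B]. cbn [fst snd].
    now rewrite pren_shift1.
  - rewrite pren_all2. apply styping_all2; [now apply Omega_ctx_pren|].
    specialize (IHstyping s0 (upren_pr n r0)).
    replace (shift2_ctx n (pren_ctx s0 r0 G)) with
      (pren_ctx s0 (upren_pr n r0) (shift2_ctx n G)); auto.
    unfold pren_ctx, shift2_ctx. rewrite !map_map. apply map_ext. intros [x B]. cbn [fst snd].
    now rewrite pren_shift2.
  - eapply styping_sub; [apply sub_pren; eassumption|apply IHstyping].
Qed.

(** * The interpretation of types *)

(** A sequent carries no type: its membership in a value plays the part of the typing. Formulas and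
    sequents live in one set because the arrow clause asks for both, formulas for domains and
    results, sequents for bodies of abstractions. *)
Inductive elt : Type :=
| EF : formula -> elt
| EL : ctx -> lterm -> elt.

Definition val : Type := elt -> Prop.

Definition down (E : term -> term -> Prop) (A : formula) : val :=
  fun x => match x with EF F => sub true E F A | EL G t => styping E G t A end.

Definition val_le (S T : val) : Prop := forall x, S x -> T x.

Lemma down_sub E A B : sub true E A B -> val_le (down E A) (down E B).
Proof.
  intros H [F | G t] Hx; cbn in *.
  - eapply s_trans; eauto; [apply (sub_wf _ _ _ _ Hx) | apply (sub_wf _ _ _ _ H)].
  - eapply styping_sub; eauto.
Qed.

(* Closure under restricted subtyping on the left for formulas, and under typing for sequents. *)
Definition closed (E : term -> term -> Prop) (V : val) : Prop :=
  forall F, V (EF F) -> val_le (down E F) V.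

Lemma closed_down E A : closed E (down E A).
Proof. intros F HF. now apply down_sub. Qed.

Definition pval : Type := list term -> val.
Definition env : Type := nat -> nat -> pval.

(* The second clause says that [P] respects the equations [E] at every position of its arguments:
   the variable 0 of [ts] marks the hole. *)
Definition adm (E : term -> term -> Prop) (P : pval) : Prop :=
  (forall ts, closed E (P ts)) /\
  (forall ts u v, eq_inst E u v ->
     val_le (P (map (subst_term (scons u TVar)) ts)) (P (map (subst_term (scons v TVar)) ts))).

(* The second disjunct adds the abstractions.  Application to a neutral function only meets the
   first one, and a positive type [A] is recovered from the second because the negative domain
   of the arrow belongs to its own interpretation. *)
Definition arrow (E : term -> term -> Prop) (S T : val) : val :=
  fun x =>
    (exists A B, Omega_pos A /\ down E (Imp A B) x /\ val_le S (down E A) /\ T (EF B)) \/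
    match x with
    | EL G (LLam z u) => forall C, Omega_neg C -> S (EF C) -> T (EL ((z, C) :: G) u)
    | _ => False
    end.

(** The clause for [Mu] is the intersection of all admissible pre-fixed points. It makes sense by
    structural recursion for any [D]; positivity enters only in [lfp_fold] and [lfp_unfold]. *)
Fixpoint sem (E : term -> term -> Prop) (A : formula) (s : nat -> term) (rho : env) : val :=
  match A with
  | Bot => down E Bot
  | PVar i ts => rho (length ts) i (map (subst_term s) ts)
  | PSym c ts => down E (PSym c (map (subst_term s) ts))
  | Imp A B => arrow E (sem E A s rho) (sem E B s rho)
  | All1 A => fun x => forall u, sem E A (scons u s) rho x
  | All2 n A => fun x => forall P, adm E P -> sem E A s (pcons n P rho) x
  | Mu D ts => fun x => forall P, adm E P ->
      (forall us, length us = length ts ->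
         val_le (sem E D (app_env us s) (pcons (length ts) P rho)) (P us)) ->
      P (map (subst_term s) ts) x
  end.

Lemma arrow_mono E S S' T T' : val_le S' S -> val_le T T' -> val_le (arrow E S T) (arrow E S' T').
Proof.
  intros HS HT x [(A & B & H1 & H2 & H3 & H4) | H].
  - left. exists A, B. repeat split; auto. intros y Hy. auto.
  - right. destruct x as [|G [| |]]; auto; intros C HC Hy; apply HT, H; auto.
Qed.

Lemma closed_arrow E S T : closed E (arrow E S T).
Proof.
  intros F [(A & B & H1 & H2 & H3 & H4) | []] x Hx.
  left. exists A, B. repeat split; auto. now apply (closed_down E (Imp A B) F).
Qed.

Definition adm_env (E : term -> term -> Prop) (rho : env) : Prop := forall m i, adm E (rho m i).

Lemma adm_pcons E n P rho : adm E P -> adm_env E rho -> adm_env E (pcons n P rho).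
Proof.
  intros HP Hr m i. unfold pcons. destruct (m =? n); [destruct i|]; auto.
Qed.

Lemma closed_sem E A s rho : adm_env E rho -> closed E (sem E A s rho).
Proof.
  revert s rho; induction A; intros s rho Hr; cbn [sem].
  - apply closed_down.
  - apply Hr.
  - apply closed_down.
  - apply closed_arrow.
  - intros F HF x Hx u. now apply (IHA _ _ Hr F).
  - intros F HF x Hx P HP. apply (IHA s (pcons n P rho)) with F; auto using adm_pcons.
  - intros F HF x Hx P HP Hpre. destruct HP as [HP1 HP2]. apply (HP1 _ F); auto.
    apply HF; auto. split; auto.
Qed.

Lemma sub_eq_step b E B u v : wf B -> eq_inst E u v -> sub b E (inst1 B u) (inst1 B v).
Proof.
  intros HB H. apply s_eq with u; auto using wf_fsubst.
  - now apply wf_fsubst.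
  - now apply wf_fsubst.
  - apply s_refl. now apply wf_fsubst.
Qed.

(** The variable 0 of the terms in [s] marks the hole. Symmetry of equation instances handles the
    contravariant side of the arrow. *)
Lemma sem_eq E A s rho u v : adm_env E rho -> eq_inst E u v ->
  val_le (sem E A (fun k => subst_term (scons u TVar) (s k)) rho)
       (sem E A (fun k => subst_term (scons v TVar) (s k)) rho).
Proof.
  (* Terms brought in by a binder are shifted past the hole, so that plugging [w] leaves them intact
     and the induction hypothesis keeps its form. *)
  assert (Hl : forall w us s,
    app_env us (fun k => subst_term (scons w TVar) (s k)) =
    fun k => subst_term (scons w TVar) (app_env (map (subst_term (fun k => TVar (S k))) us) s k)).
  { intros w us s'. rewrite app_env_subst, map_subst_term_comp. cbn.
    now rewrite map_subst_term_id. }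
  revert s rho u v; induction A; intros s rho u v Hr He; cbn [sem].
  - intros x Hx; exact Hx.
  - rewrite <- !map_subst_term_comp. now apply Hr.
  - rewrite <- !map_subst_term_comp. apply down_sub.
    apply (sub_eq_step true E (PSym n (map (subst_term s) l))); [exact I | assumption].
  - apply arrow_mono; auto using eq_inst_sym.
  - intros x Hx w. specialize (Hx w). rewrite scons_app_env, Hl in *.
    revert Hx. now apply IHA.
  - intros x Hx P HP. apply IHA with u; auto using adm_pcons.
  - intros x Hx P HP Hpre. rewrite <- map_subst_term_comp. apply (proj2 HP _ u v He).
    rewrite map_subst_term_comp. apply Hx; [assumption|].
    intros us Hus y Hy. apply Hpre; [assumption|].
    rewrite Hl in *. revert Hy. apply IHA; auto using adm_pcons.
Qed.

(** * Monotonicity and extensionality of the interpretation *)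

(** The comparison is demanded only at variables that occur with the given sign and at argument
    lists of the right length. Positivity of the body of a [Mu] then discharges the contravariant
    condition at its bound variable. *)
Lemma sem_mono E A s rho rho' :
  (forall m i ts, has_occ m i true A = true -> length ts = m ->
     val_le (rho m i ts) (rho' m i ts)) ->
  (forall m i ts, has_occ m i false A = true -> length ts = m ->
     val_le (rho' m i ts) (rho m i ts)) ->
  val_le (sem E A s rho) (sem E A s rho').
Proof.
  assert (Hc : forall b n P (D : formula) (rho rho' : env),
    (forall m i ts, has_occ m (if n =? m then S i else i) b D = true -> length ts = m ->
       val_le (rho m i ts) (rho' m i ts)) ->
    forall m i ts, has_occ m i b D = true -> length ts = m ->
      val_le (pcons n P rho m i ts) (pcons n P rho' m i ts)).
  { clear. intros b n P D rho rho' H m i ts Ho Ht. specialize (H m).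
    unfold pcons. rewrite (Nat.eqb_sym n m) in H.
    destruct (m =? n); [destruct i; [intros x Hx; exact Hx|]|]; auto. }
  revert s rho rho'; induction A; intros s rho rho' Hp Hn; cbn [sem].
  - intros x Hx; exact Hx.
  - apply Hp; [cbn; now rewrite !Nat.eqb_refl | now rewrite length_map].
  - intros x Hx; exact Hx.
  - apply arrow_mono; [apply IHA1 | apply IHA2]; intros m i ts Ho Ht.
    + apply Hn; cbn; auto. now rewrite Ho.
    + apply Hp; cbn; auto. now rewrite Ho.
    + apply Hp; cbn; auto. now rewrite Ho, orb_true_r.
    + apply Hn; cbn; auto. now rewrite Ho, orb_true_r.
  - intros x Hx u. revert x Hx.
    assert (H : val_le (sem E A (scons u s) rho) (sem E A (scons u s) rho')) by now apply IHA.
    intros x Hx. apply H, Hx.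
  - intros x Hx P HP. apply (IHA s (pcons n P rho)); auto.
    + now apply Hc.
    + now apply Hc.
  - intros x Hx P HP Hpre. apply Hx; [assumption|].
    intros us Hus y Hy. apply Hpre; [assumption|]. revert y Hy.
    apply IHA; now apply Hc.
Qed.

(** Turns mutual inclusion into equality, so that facts about the interpretation can be used for
    rewriting. *)
Lemma val_ext (S T : val) : val_le S T -> val_le T S -> S = T.
Proof.
  intros H1 H2. extensionality x. apply propositional_extensionality. split; auto.
Qed.

Lemma sem_ext E A s rho rho' :
  (forall m i ts, length ts = m -> rho m i ts = rho' m i ts) ->
  sem E A s rho = sem E A s rho'.
Proof.
  intro H. apply val_ext; apply sem_mono; intros m i ts _ Ht;
    rewrite H by assumption; intros x Hx; exact Hx.
Qed.

(** * Substitution lemmas for the interpretation *)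

Lemma upn1_scons (u : term) (s s' : nat -> term) :
  (fun k => subst_term (scons u s') (upn 1 s k)) = scons u (fun k => subst_term s' (s k)).
Proof. rewrite !scons_app_env. now apply upn_app_env. Qed.

Lemma sem_fsubst E A s s' rho :
  sem E (fsubst s A) s' rho = sem E A (fun k => subst_term s' (s k)) rho.
Proof.
  revert s s' rho; induction A; intros s s' rho; rewrite ?fsubst_all1; cbn [fsubst sem];
    rewrite ?length_map, ?map_subst_term_comp; auto.
  - now rewrite IHA1, IHA2.
  - extensionality x. apply propositional_extensionality.
    split; intros H u; specialize (H u); rewrite IHA, upn1_scons in *; assumption.
  - extensionality x. apply propositional_extensionality.
    split; intros H P HP; specialize (H P HP); rewrite IHA in *; assumption.
  - extensionality x. apply propositional_extensionality.
    split; intros H P HP Hpre; apply H; auto; intros us Hus y Hy; apply Hpre; auto;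
      rewrite IHA, upn_app_env in *; assumption.
Qed.

Lemma sem_ren_pr E A r s rho :
  sem E (ren_pr r A) s rho = sem E A s (fun m i => rho m (r m i)).
Proof.
  assert (Hc : forall n P (rho : env) r,
    (fun m i => pcons n P rho m (upren_pr n r m i)) = pcons n P (fun m i => rho m (r m i))).
  { intros. extensionality m; extensionality i. unfold pcons, upren_pr.
    destruct (m =? n); [destruct i|]; reflexivity. }
  revert r s rho; induction A; intros r s rho; cbn [ren_pr sem]; auto.
  - now rewrite IHA1, IHA2.
  - extensionality x. apply propositional_extensionality.
    split; intros H u; specialize (H u); rewrite IHA in *; assumption.
  - extensionality x. apply propositional_extensionality.
    split; intros H P HP; specialize (H P HP); rewrite IHA, Hc in *; assumption.
  - extensionality x. apply propositional_extensionality.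
    split; intros H P HP Hpre; apply H; auto; intros us Hus y Hy; apply Hpre; auto;
      rewrite IHA, Hc in *; assumption.
Qed.

Definition sem_env (E : term -> term -> Prop) (tau : nat -> nat -> formula) (s : nat -> term)
    (rho : env) : env :=
  fun m i ts => sem E (tau m i) (app_env ts s) rho.

Lemma sem_pid E m i s rho ts : length ts = m -> sem E (pid m i) (app_env ts s) rho = rho m i ts.
Proof.
  intros <-. unfold pid. cbn. now rewrite length_params, map_params_app_env.
Qed.

Lemma sem_lift_abs E m n G us s rho : forall ts, length ts = m -> length us = n ->
  sem E (lift_abs m n G) (app_env ts (app_env us s)) rho = sem E G (app_env ts s) rho.
Proof.
  intros ts <- <-. rewrite lift_abs_fsubst, sem_fsubst. f_equal. extensionality k.
  unfold lift_index. sigma; try reflexivity. f_equal. lia.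
Qed.

Lemma sem_env_up E n P tau s rho m i ts : length ts = m ->
  sem_env E (up_pr n tau) s (pcons n P rho) m i ts = pcons n P (sem_env E tau s rho) m i ts.
Proof.
  intro Ht.
  assert (H : forall A s', sem E (ren_pr (shift_pr n) A) s' (pcons n P rho) = sem E A s' rho).
  { intros. rewrite sem_ren_pr. f_equal. extensionality p; extensionality q.
    unfold pcons, shift_pr. now destruct (p =? n). }
  unfold sem_env, up_pr. destruct (Nat.eqb_spec m n) as [Hmn|Hmn]; [destruct i|].
  - rewrite sem_pid by assumption. unfold pcons. apply Nat.eqb_eq in Hmn. now rewrite Hmn.
  - rewrite H. unfold pcons. apply Nat.eqb_eq in Hmn. now rewrite Hmn.
  - rewrite H. unfold pcons. apply Nat.eqb_neq in Hmn. now rewrite Hmn.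
Qed.

(** Syntactic substitution becomes a change of environment. Together with [adm_sem] this makes
    instantiation by an arbitrary abstraction sound. *)
Lemma sem_subst_form E A s tau s' rho :
  sem E (subst_form s tau A) s' rho =
  sem E A (fun k => subst_term s' (s k)) (sem_env E tau s' rho).
Proof.
  revert s tau s' rho; induction A; intros s tau s' rho;
    rewrite ?subst_form_all1, ?subst_form_mu; cbn [subst_form sem];
    rewrite ?length_map, ?map_subst_term_comp; auto.
  - unfold inst_abs. rewrite sem_fsubst, args_subst_app_env, app_env_subst, map_subst_term_comp.
    reflexivity.
  - now rewrite IHA1, IHA2.
  - assert (H : forall u, sem E (subst_form (upn 1 s) (lift_env 1 tau) A) (scons u s') rho =
      sem E A (scons u (fun k => subst_term s' (s k))) (sem_env E tau s' rho)).
    { intro u. rewrite IHA, upn1_scons. apply sem_ext. intros m i ts Ht.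
      unfold sem_env, lift_env. rewrite scons_app_env. now apply sem_lift_abs. }
    extensionality x. apply propositional_extensionality.
    split; intros Hx u; specialize (Hx u); rewrite H in *; assumption.
  - assert (H : forall P, sem E (subst_form s (up_pr n tau) A) s' (pcons n P rho) =
      sem E A (fun k => subst_term s' (s k)) (pcons n P (sem_env E tau s' rho))).
    { intro P. rewrite IHA. apply sem_ext. intros. now apply sem_env_up. }
    extensionality x. apply propositional_extensionality.
    split; intros Hx P HP; specialize (Hx P HP); rewrite H in *; assumption.
  - assert (H : forall us P, length us = length l ->
      sem E (subst_form (upn (length l) s) (lift_env (length l) (up_pr (length l) tau)) A)
        (app_env us s') (pcons (length l) P rho) =
      sem E A (app_env us (fun k => subst_term s' (s k)))
        (pcons (length l) P (sem_env E tau s' rho))).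
    { intros us P Hus. rewrite IHA, upn_app_env by assumption. apply sem_ext.
      intros m i ts Ht. rewrite <- sem_env_up by assumption. unfold sem_env, lift_env.
      now apply sem_lift_abs. }
    extensionality x. apply propositional_extensionality.
    split; intros Hx P HP Hpre; apply Hx; auto; intros us Hus y Hy; apply Hpre; auto;
      rewrite H in *; assumption.
Qed.

(** * Soundness *)

(** Semantic comprehension: the family denoted by any formula is among those over which the
    predicate quantifier ranges. *)
Lemma adm_sem E G s rho : adm_env E rho -> adm E (fun ts => sem E G (app_env ts s) rho).
Proof.
  intro Hr. split.
  - intro ts. now apply closed_sem.
  - intros ts u v He x Hx.
    (* Writing [s] as its own shift followed by the plugging of [w] leaves the hole 0 to [ts] alone,
       which is the form required by [sem_eq]. *)
    assert (Hl : forall w, app_env (map (subst_term (scons w TVar)) ts) s =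
      fun k => subst_term (scons w TVar) (app_env ts (fun k => subst_term (fun i => TVar (S i)) (s k)) k)).
    { intro w. rewrite app_env_subst. f_equal. extensionality k.
      rewrite subst_term_comp. cbn. now rewrite subst_term_id. }
    rewrite Hl in *. revert Hx. now apply sem_eq.
Qed.

Lemma sem_pscons E n G A s0 s rho :
  sem E (subst_form s0 (pscons n G) A) s rho =
  sem E A (fun k => subst_term s (s0 k))
    (pcons n (fun ts => sem E G (app_env ts s) rho) rho).
Proof.
  rewrite sem_subst_form. apply sem_ext. intros m i ts Ht. unfold sem_env, pscons, pcons.
  destruct (m =? n); [destruct i|]; auto using sem_pid.
Qed.

Lemma fun_subst_id (s : nat -> term) : (fun k => subst_term s (TVar k)) = s.
Proof. reflexivity. Qed.

(* Arguments of the wrong length are unconstrained in the fixed-point condition. *)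
Definition lfp (E : term -> term -> Prop) (D : formula) (n : nat) (s : nat -> term) (rho : env) :
    pval :=
  fun us x => forall P, adm E P ->
    (forall us, length us = n -> val_le (sem E D (app_env us s) (pcons n P rho)) (P us)) ->
    P us x.

Lemma sem_mu_params E n D s rho us : length us = n ->
  sem E (Mu (lift_abs n n D) (params n)) (app_env us s) rho = lfp E D n s rho us.
Proof.
  intro Hus. unfold lfp. cbn. rewrite length_params.
  replace (map (subst_term (app_env us s)) (params n)) with us
    by now rewrite <- Hus, map_params_app_env.
  extensionality x. apply propositional_extensionality.
  split; intros Hx P HP Hpre; apply Hx; auto; intros ws Hws y Hy; apply Hpre; auto;
    rewrite sem_lift_abs in *; assumption.
Qed.

Lemma inst1_sem E A u s rho : sem E (inst1 A u) s rho = sem E A (scons (subst_term s u) s) rho.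
Proof.
  unfold inst1. rewrite sem_fsubst. f_equal. extensionality k. now destruct k.
Qed.

Lemma sem_inst_abs E G ts s rho :
  sem E (inst_abs G ts) s rho = sem E G (app_env (map (subst_term s) ts) s) rho.
Proof.
  unfold inst_abs. rewrite sem_fsubst, args_subst_app_env, app_env_subst. reflexivity.
Qed.

Lemma sem_shift1 E A u s rho : sem E (shift1 A) (scons u s) rho = sem E A s rho.
Proof. unfold shift1. now rewrite ren_fo_fsubst, sem_fsubst. Qed.

Lemma sem_shift2 E n A P s rho : sem E (shift2 n A) s (pcons n P rho) = sem E A s rho.
Proof.
  unfold shift2. rewrite sem_ren_pr. f_equal. extensionality m; extensionality i.
  unfold pcons, shift_pr. now destruct (m =? n).
Qed.

Lemma adm_lfp E D n s rho : adm E (lfp E D n s rho).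
Proof.
  split.
  - intros ts F HF x Hx P HP Hpre. apply (proj1 HP ts F); auto. now apply HF.
  - intros ts u v He x Hx P HP Hpre. apply (proj2 HP ts u v He). now apply Hx.
Qed.

(** First half of the Knaster-Tarski argument: [lfp] lies below each admissible pre-fixed point [P],
    so by monotonicity its image lies below the image of [P], hence below [P]. *)
Lemma lfp_fold E D n s rho us : positive n 0 D = true -> length us = n ->
  val_le (sem E D (app_env us s) (pcons n (lfp E D n s rho) rho)) (lfp E D n s rho us).
Proof.
  intros Hpos Hus x Hx P HP Hpre. apply Hpre; [assumption|]. revert x Hx.
  unfold positive in Hpos. apply negb_true_iff in Hpos.
  apply sem_mono; intros m i ts Ho Ht; unfold pcons; destruct (Nat.eqb_spec m n);
    try (intros x Hx; exact Hx); subst; destruct i; try (intros x Hx; exact Hx).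
  - intros x Hx. apply Hx; auto.
  - congruence.
Qed.

(** Second half: the image of [lfp] is admissible by [adm_sem], and it is a pre-fixed point by
    monotonicity applied to [lfp_fold]. Leastness concludes. *)
Lemma lfp_unfold E D n s rho us : adm_env E rho -> positive n 0 D = true -> length us = n ->
  val_le (lfp E D n s rho us) (sem E D (app_env us s) (pcons n (lfp E D n s rho) rho)).
Proof.
  intros Hr Hpos Hus x Hx.
  apply (Hx (fun us => sem E D (app_env us s) (pcons n (lfp E D n s rho) rho))).
  - apply adm_sem, adm_pcons; auto using adm_lfp.
  - intros ws Hws.
    assert (Hn : has_occ n 0 false D = false) by now apply negb_true_iff.
    apply sem_mono; intros m i ts Ho Ht; unfold pcons; destruct (Nat.eqb_spec m n);
      try (intros y Hy; exact Hy); subst; destruct i; try (intros y Hy; exact Hy).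
    + now apply lfp_fold.
    + congruence.
Qed.

Lemma sem_unfold_mu E D ts s rho :
  sem E (unfold_mu D ts) s rho =
  sem E D (app_env (map (subst_term s) ts) s)
    (pcons (length ts) (lfp E D (length ts) s rho) rho).
Proof.
  unfold unfold_mu. rewrite sem_pscons, args_subst_app_env, app_env_subst.
  apply sem_ext. intros m i us Hus. unfold pcons. destruct (Nat.eqb_spec m (length ts));
    [destruct i|]; try reflexivity.
  apply sem_mu_params. congruence.
Qed.

(** The flag does not matter here: the instances of the full relation are covered by comprehension,
    the rules for [Mu] by the properties of the least fixed point. *)
Lemma sub_sound b E A B : sub b E A B -> forall s rho, adm_env E rho ->
  val_le (sem E A s rho) (sem E B s rho).
Proof.
  induction 1; intros s0 rho Hr.
  - intros x Hx; exact Hx.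
  - apply arrow_mono; auto.
  - intros x Hx. apply IHsub; [assumption|]. rewrite inst1_sem. apply Hx.
  - intros x Hx. apply IHsub; [assumption|]. unfold inst2. rewrite sem_pscons.
    apply Hx. now apply adm_sem.
  - intros x Hx u. apply IHsub; [assumption|]. now rewrite sem_shift1.
  - intros x Hx P HP. apply IHsub; [now apply adm_pcons|]. now rewrite sem_shift2.
  - intros x Hx. apply IHsub in Hx; [|assumption]. rewrite inst1_sem in *.
    apply (eq_inst_subst E s0) in H1.
    (* The equation clause of admissibility is used at arity 1, on the list whose only entry is the
       hole itself. *)
    pose proof (proj2 (adm_sem E B s0 rho Hr) [TVar 0] _ _ H1 x) as K. cbn in K.
    rewrite !scons_app_env in *. now apply K.
  - intros x Hx. apply IHsub2; auto. apply IHsub1; auto.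
  - rewrite sem_unfold_mu. apply lfp_fold; [apply H0 | now rewrite length_map].
  - rewrite sem_unfold_mu. apply lfp_unfold; [assumption | apply H | now rewrite length_map].
  - rewrite sem_inst_abs. intros x Hx.
    (* The premise of the induction rule says that the family denoted by [Ef] is one of the
       pre-fixed points being intersected. *)
    apply (Hx (fun ts => sem E Ef (app_env ts s0) rho)); [now apply adm_sem|].
    intros us Hus y Hy. apply IHsub; [assumption|]. rewrite sem_pscons, fun_subst_id.
    revert y Hy. apply sem_mono; intros m i ws Ho Hws; unfold pcons;
      destruct (Nat.eqb_spec m (length ts)); try (intros y Hy; exact Hy); subst;
      destruct i; try (intros y Hy; exact Hy);
      rewrite sem_lift_abs by congruence; intros y Hy; exact Hy.
Qed.

(** * Completeness *)

Lemma styping_ctx E G t A : styping E G t A -> Omega_ctx G.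
Proof. induction 1; auto. now inversion IHstyping. Qed.

(** The rules of [styping] carry no well-formedness premises; these are recovered from the
    negativity of contexts and from the conditions built into [sub]. *)
Lemma styping_wf E G t A : styping E G t A -> wf A.
Proof.
  induction 1; cbn in *; try tauto.
  - apply wf_Omega_neg. apply lookup_In in H0. unfold Omega_ctx in H.
    rewrite Forall_forall in H. apply (H _ H0).
  - split; [|assumption]. apply styping_ctx in H. inversion H; subst. now apply wf_Omega_neg.
  - apply (sub_wf _ _ _ _ H).
Qed.

Definition elt_pren (s : nat -> term) (r : nat -> nat -> nat) (x : elt) : elt :=
  match x with EF F => EF (pren s r F) | EL G t => EL (pren_ctx s r G) t end.

Definition elt_bound (x : elt) : nat :=
  match x with EF F => bound F | EL G _ => list_max (map (fun p => bound (snd p)) G) end.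

Lemma down_pren E A x s r : down E A x -> down E (pren s r A) (elt_pren s r x).
Proof. destruct x; cbn; intro H; [now apply sub_pren | now apply styping_pren]. Qed.

Lemma elt_pren_ext_bound s s' r r' b x :
  (forall k, k < b -> s k = s' k) -> (forall m k, k < b -> r m k = r' m k) ->
  elt_bound x <= b -> elt_pren s r x = elt_pren s' r' x.
Proof.
  intros Hs Hr Hb. destruct x as [F | G t]; cbn in *; f_equal.
  - eapply pren_ext_bound; eauto.
  - apply list_max_map_le in Hb. apply map_ext_Forall. revert Hb. apply Forall_impl.
    intros p Hp. f_equal. eapply pren_ext_bound; eauto.
Qed.


(* With [k] fresh, the renaming that sends [k] to 0 and shifts everything else turns [T[k/x]]
   into [T] and [x] into its shift. *)
Lemma down_all1 E T k x : bound T <= k -> elt_bound x <= k ->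
  down E (inst1 T (TVar k)) x -> down E (All1 T) x.
Proof.
  intros HT Hx H.
  set (s := fun i => TVar (if i =? k then 0 else S i)).
  pose proof (down_pren _ _ _ s (fun _ i => i) H) as K.
  rewrite pren_inst1 in K. unfold inst1 in K. rewrite fsubst_pren_comp in K.
  rewrite (pren_ext_bound _ TVar _ (fun _ i => i) k), pren_id in K; auto.
  2:{ intros i Hi. destruct i as [|i]; cbn.
      - unfold s. now rewrite Nat.eqb_refl.
      - unfold s. cbn. case_index. reflexivity. }
  rewrite (elt_pren_ext_bound s (fun i => TVar (S i)) _ (fun _ i => i) k) in K; auto.
  2:{ intros i Hi. unfold s. now case_index. }
  destruct x as [F | G t]; cbn in *.
  - apply s_all1_r; rewrite ?shift1_pren; auto; [apply (sub_wf _ _ _ _ H) | apply (sub_wf _ _ _ _ K)].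
  - apply styping_all1; rewrite ?shift1_ctx_pren; auto. now apply styping_ctx in H.
Qed.

Lemma inst2_pid n T j : inst2 n T (pid n j) =
  pren TVar (fun m i => if m =? n then match i with 0 => j | S i' => i' end else i) T.
Proof.
  unfold inst2, pren. f_equal. extensionality m; extensionality i. unfold pscons, ren_env.
  destruct (Nat.eqb_spec m n); [subst; destruct i|]; reflexivity.
Qed.

(** With [j] fresh, [r] sends [j] to 0 and shifts the other indices of arity [n]: the instance
    becomes [T] again and [x] becomes its weakening, so the right rule applies. *)
Lemma down_all2 E n T j x : bound T <= j -> elt_bound x <= j ->
  down E (inst2 n T (pid n j)) x -> down E (All2 n T) x.
Proof.
  intros HT Hx H.
  set (r := fun m i => if m =? n then if i =? j then 0 else S i else i).
  pose proof (down_pren _ _ _ TVar r H) as K.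
  rewrite inst2_pid, pren_comp in K.
  rewrite (pren_ext_bound _ TVar _ (fun _ i => i) j), pren_id in K; auto.
  2:{ intros m i Hi. unfold r. destruct (m =? n); [destruct i as [|i]|]; auto.
      - now rewrite Nat.eqb_refl.
      - now case_index. }
  rewrite (elt_pren_ext_bound TVar TVar r (shift_pr n) j) in K; auto.
  2:{ intros m i Hi. unfold r, shift_pr. now case_index. }
  destruct x as [F | G t]; cbn in *.
  - apply s_all2_r; rewrite ?shift2_pren; auto; [apply (sub_wf _ _ _ _ H) | apply (sub_wf _ _ _ _ K)].
  - apply styping_all2; rewrite ?shift2_ctx_pren; auto. now apply styping_ctx in H.
Qed.

(** Opening a substituted body amounts to substituting with an extended environment, the form in
    which the induction hypotheses of [completeness] are available. *)
Lemma inst1_subst_form u s tau T :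
  inst1 (subst_form (upn 1 s) (lift_env 1 tau) T) u = subst_form (scons u s) tau T.
Proof.
  unfold inst1. change (fun k => match k with 0 => u | S k' => TVar k' end) with (scons u TVar).
  rewrite fsubst_subst_form. f_equal.
  - rewrite upn1_scons. f_equal. extensionality k. apply subst_term_id.
  - extensionality m; extensionality i. unfold lift_env. rewrite scons_app_env.
    now apply lift_args_cancel.
Qed.


Lemma subst_shift_cancel n m G s A :
  subst_form (upn m s) (lift_env m (pscons n G)) (ren_pr (shift_pr n) A) = fsubst (upn m s) A.
Proof.
  rewrite subst_form_ren_pr, <- subst_form_pid. f_equal.
  rewrite <- (lift_env_pid m). extensionality p; extensionality i.
  unfold lift_env, pscons, shift_pr. now destruct (p =? n).
Qed.

Lemma inst2_subst_form n G s tau T :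
  inst2 n (subst_form s (up_pr n tau) T) G = subst_form s (pcons n G tau) T.
Proof.
  unfold inst2. rewrite subst_form_comp. f_equal.
  - extensionality k. apply subst_term_id.
  - extensionality m; extensionality i. unfold comp_env, up_pr, pcons.
    destruct (Nat.eqb_spec m n) as [->|]; [destruct i|].
    + rewrite lift_inst_pid. unfold pscons. now rewrite Nat.eqb_refl.
    + now rewrite subst_shift_cancel, upn_id, fsubst_id.
    + now rewrite subst_shift_cancel, upn_id, fsubst_id.
Qed.

(** The same for fixed points: the unfolding of the substituted [Mu] is [D] under an environment
    that sends its bound predicate to that very [Mu]. *)
Lemma unfold_mu_subst_form n us s tau D D' : length us = n ->
  D' = subst_form (upn n s) (lift_env n (up_pr n tau)) D ->
  unfold_mu D' us =
  subst_form (app_env us s) (pcons n (Mu (lift_abs n n D') (params n)) tau) D.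
Proof.
  intros Hn HD. unfold unfold_mu. rewrite Hn.
  generalize (Mu (lift_abs n n D') (params n)) as G. intro G.
  rewrite HD, subst_form_comp, args_subst_app_env. f_equal.
  - rewrite upn_app_env by assumption. f_equal. extensionality k. apply subst_term_id.
  - extensionality m; extensionality i. unfold comp_env, lift_env at 2.
    rewrite lift_abs_fsubst, subst_form_fsubst.
    assert (Hs : (fun k => subst_term (upn m (app_env us TVar)) (lift_index m n k)) = TVar).
    { extensionality k. unfold lift_index. sigma; f_equal; lia. }
    rewrite Hs. clear Hs. unfold up_pr, pcons.
    destruct (Nat.eqb_spec m n) as [->|]; [destruct i|].
    + rewrite <- (upn_id n), lift_inst_pid. unfold pscons. now rewrite Nat.eqb_refl.
    + now rewrite <- (upn_id n), subst_shift_cancel, upn_id, fsubst_id.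
    + now rewrite <- (upn_id m), subst_shift_cancel, upn_id, fsubst_id.
Qed.

(* [G] and [P] are comparable in the direction required at an occurrence of sign [b] inside a
   positive formula. *)
Definition approx (E : term -> term -> Prop) (b : bool) (m : nat) (G : formula) (P : pval) : Prop :=
  Omega b G /\
  forall ts, length ts = m ->
    if b then val_le (P ts) (down E (inst_abs G ts)) else P ts (EF (inst_abs G ts)).

Definition agree (E : term -> term -> Prop) (b : bool) (A : formula)
    (tau : nat -> nat -> formula) (rho : env) : Prop :=
  forall m i c, has_occ m i c A = true -> approx E (Bool.eqb c b) m (tau m i) (rho m i).

Lemma agree_Omega_env E b A tau rho : agree E b A tau rho -> Omega_env b A tau.
Proof. intros H m i c Ho. now apply H. Qed.

Lemma agree_imp_l E b A B tau rho : agree E b (Imp A B) tau rho -> agree E (negb b) A tau rho.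
Proof.
  intros H m i c Ho. replace (Bool.eqb c (negb b)) with (Bool.eqb (negb c) b)
    by now destruct c, b.
  apply H. cbn. now rewrite negb_involutive, Ho.
Qed.

Lemma agree_imp_r E b A B tau rho : agree E b (Imp A B) tau rho -> agree E b B tau rho.
Proof. intros H m i c Ho. apply H. cbn. now rewrite Ho, orb_true_r. Qed.

Lemma agree_pcons E b n A G P tau rho :
  (forall m i c, has_occ m (if n =? m then S i else i) c A = true ->
     approx E (Bool.eqb c b) m (tau m i) (rho m i)) ->
  (forall c, has_occ n 0 c A = true -> approx E (Bool.eqb c b) n G P) ->
  agree E b A (pcons n G tau) (pcons n P rho).
Proof.
  intros H H0 m i c Ho. specialize (H m). rewrite (Nat.eqb_sym n m) in H. unfold pcons.
  destruct (Nat.eqb_spec m n); [subst; destruct i|]; auto.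
Qed.

(** A predicate variable denoting its own down-set matches its syntax in both directions, so it may
    be put for a quantified variable that occurs with both signs. *)
Lemma approx_var E b n j : approx E b n (pid n j) (fun ts => down E (PVar j ts)).
Proof.
  split; [apply Omega_pid|]. intros ts <-. rewrite inst_abs_pid.
  destruct b; [intros x Hx; exact Hx|]. apply s_refl. exact I.
Qed.

Lemma adm_var E j : adm E (fun ts => down E (PVar j ts)).
Proof.
  split; [intro; apply closed_down|]. intros ts u v H. apply down_sub.
  now apply (sub_eq_step true E (PVar j ts)).
Qed.

Lemma inst_abs_mu D n ts : length ts = n ->
  inst_abs (Mu (lift_abs n n D) (params n)) ts = Mu D ts.
Proof.
  intros <-. unfold inst_abs. cbn [fsubst]. rewrite length_params, args_subst_app_env,
    map_params_app_env. now rewrite lift_args_cancel.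
Qed.


Lemma inst1_mu_shift D ts u :
  inst1 (Mu (lift_abs (length ts) 1 D) ts) u = Mu D (map (subst_term (scons u TVar)) ts).
Proof.
  unfold inst1. change (fun k => match k with 0 => u | S k' => TVar k' end) with (scons u TVar).
  cbn [fsubst]. f_equal. rewrite scons_app_env. now apply lift_args_cancel.
Qed.

(** The hole sits only in the arguments, so replacing equals there is an instance of the equation
    rule for the [Mu] whose body has been shifted past it. *)
Lemma adm_mu E D : adm E (fun ts => down E (Mu D ts)).
Proof.
  split; [intro; apply closed_down|]. intros ts u v H x Hx.
  (* Well-formedness of the [Mu] is not assumed; it is extracted from the element [x] below it. *)
  assert (Hw : wf (Mu D (map (subst_term (scons u TVar)) ts))).
  { destruct x; cbn in Hx; [apply (sub_wf _ _ _ _ Hx) | now apply styping_wf in Hx]. }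
  revert Hx. apply down_sub. rewrite <- !inst1_mu_shift in *.
  apply sub_eq_step; [|assumption]. now apply wf_fsubst_inv in Hw.
Qed.

Lemma Omega_pos_mu_inv D ts : Omega_pos (Mu D ts) ->
  occurs (length ts) 0 D = true /\ positive (length ts) 0 D = true /\ Omega_pos D.
Proof. inversion 1; auto. Qed.

(** The arrow exchanges the two halves, hence the simultaneous induction. [tau] and [rho] vary
    because each binder adds an abstraction and a family, comparable only at the signs with which
    the variable occurs. *)
Lemma completeness E :
  (forall A, Omega_pos A -> forall s tau rho, adm_env E rho -> agree E true A tau rho ->
     val_le (sem E A s rho) (down E (subst_form s tau A))) /\
  (forall A, Omega_neg A -> forall s tau rho, adm_env E rho -> agree E false A tau rho ->
     sem E A s rho (EF (subst_form s tau A))).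
Proof.
  apply Omega_ind.
  - intros s tau rho _ _ x Hx. exact Hx.
  - intros i args s tau rho _ H. cbn [sem subst_form].
    apply (H (length args) i true); [cbn; now rewrite !Nat.eqb_refl | now rewrite length_map].
  - intros c args s tau rho _ _ x Hx. exact Hx.
  - intros A B HA IHA HB IHB s tau rho Hr Ha x Hx.
    pose proof (agree_imp_l _ _ _ _ _ _ Ha) as HaA. apply agree_imp_r in Ha.
    pose proof (agree_Omega_env _ _ _ _ _ HaA) as HO.
    apply (proj2 Omega_subst_form A HA s) in HO.
    specialize (IHA s tau rho Hr HaA). specialize (IHB s tau rho Hr Ha). cbn [subst_form].
    destruct Hx as [(A' & B' & H1 & H2 & H3 & H4) | Hx].
    (* The substituted [A] lies in its own interpretation, hence below [A'], while [B'] lies below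
       the substituted [B]; the arrow rule compares the two arrows. *)
    + apply H3 in IHA. apply IHB in H4. cbn in IHA, H4.
      destruct (sub_wf _ _ _ _ IHA), (sub_wf _ _ _ _ H4).
      revert H2. apply down_sub. apply s_arrow; cbn; auto.
    (* An abstraction is tested with its variable declared at the substituted [A], which is negative
       and belongs to its own interpretation. *)
    + destruct x as [|G [| |z u]]; try contradiction. cbn. apply styping_lam.
      apply (IHB (EL _ u)). now apply Hx.
  - intros T HT IH s tau rho Hr Ha x Hx. rewrite subst_form_all1.
    (* [k] exceeds every index in the body and in [x]; the intersection is used only at this fresh
       variable. *)
    set (T' := subst_form _ _ _). set (k := Nat.max (bound T') (elt_bound x)).
    apply (down_all1 E T' k); try lia. unfold T'. rewrite inst1_subst_form.
    apply (IH (scons (TVar k) s) tau rho); auto.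
  - intros n T HT IH s tau rho Hr Ha x Hx. cbn [subst_form].
    set (T' := subst_form _ _ _). set (k := Nat.max (bound T') (elt_bound x)).
    apply (down_all2 E n T' k); try lia. unfold T'. rewrite inst2_subst_form.
    apply (IH s _ (pcons n (fun ts => down E (PVar k ts)) rho)).
    + apply adm_pcons; auto using adm_var.
    + apply agree_pcons; auto using approx_var.
    + apply Hx, adm_var.
  - intros D ts Ho Hp HD IH s tau rho Hr Ha x Hx. rewrite subst_form_mu.
    set (n := length ts) in *. set (D' := subst_form _ _ _).
    assert (HOm : Omega_pos (Mu D' (map (subst_term s) ts))).
    { pose proof (agree_Omega_env _ _ _ _ _ Ha) as HO.
      now apply (proj1 Omega_subst_form (Mu D ts) (Opos_mu _ _ Ho Hp HD) s) in HO. }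
    assert (HOn : forall us, length us = n -> Omega_pos (Mu D' us)).
    { intros us Hus. apply Omega_pos_mu_inv in HOm. rewrite length_map in HOm. fold n in HOm.
      constructor; rewrite ?Hus; apply HOm. }
    (* Leastness is used against a syntactic family, which is a pre-fixed point thanks to the
       induction hypothesis and the restricted fold rule. *)
    apply (Hx (fun us => down E (Mu D' us))); [apply adm_mu|].
    intros us Hus y Hy.
    assert (Hag : agree E true D (pcons n (Mu (lift_abs n n D') (params n)) tau)
                    (pcons n (fun us => down E (Mu D' us)) rho)).
    { apply agree_pcons; [exact Ha|]. intros c Hc. destruct c.
      - split.
        + specialize (HOn (params n) (length_params n)).
          apply Omega_pos_mu_inv in HOn. rewrite length_params in HOn.
          rewrite lift_abs_fsubst.
          constructor; rewrite ?length_params, ?occurs_fsubst, ?positive_fsubst; try apply HOn.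
          apply (Omega_any_fsubst true), HOn.
        + intros vs Hvs. rewrite inst_abs_mu by assumption. intros z Hz. exact Hz.
      (* A negative occurrence would force the [Mu] into [Omega_neg], which has no rule for it;
         positivity excludes the case. *)
      - unfold positive in Hp. apply negb_true_iff in Hp. congruence. }
    apply (IH _ _ _ (adm_pcons _ _ _ _ (adm_mu E D') Hr) Hag) in Hy.
    revert Hy. apply down_sub.
    pose proof (unfold_mu_subst_form n us s tau D D' Hus eq_refl) as Hu.
    rewrite <- Hu. apply s_fold.
    + rewrite Hu. apply wf_Omega_pos, Omega_subst_form; [assumption|].
      eapply agree_Omega_env, Hag.
    + now apply wf_Omega_pos, HOn.
  - intros s tau rho _ _. apply s_refl. exact I.
  - intros i args s tau rho _ H. cbn [sem subst_form].
    apply (H (length args) i true); [cbn; now rewrite !Nat.eqb_refl | now rewrite length_map].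
  - intros c args s tau rho _ _. apply s_refl. exact I.
  - intros A B HA IHA HB IHB s tau rho Hr Ha. cbn [subst_form sem].
    pose proof (agree_imp_l _ _ _ _ _ _ Ha) as HaA. apply agree_imp_r in Ha.
    pose proof (agree_Omega_env _ _ _ _ _ HaA) as HO.
    pose proof (agree_Omega_env _ _ _ _ _ Ha) as HO'.
    apply (proj1 Omega_subst_form A HA s) in HO.
    apply (proj2 Omega_subst_form B HB s) in HO'.
    (* The recorded intermediate type is the arrow itself, whose domain is positive because the
       arrow is negative. *)
    left. exists (subst_form s tau A), (subst_form s tau B). repeat split; auto.
    apply s_refl. split; [now apply wf_Omega_pos | now apply wf_Omega_neg].
  - intros T HT IH s tau rho Hr Ha u. rewrite subst_form_all1.
    specialize (IH (scons u s) tau rho Hr Ha). rewrite <- inst1_subst_form in IH.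
    apply (closed_sem E T (scons u s) rho Hr _ IH).
    assert (Hw : wf (All1 (subst_form (upn 1 s) (lift_env 1 tau) T))).
    { rewrite <- subst_form_all1. apply wf_Omega_neg, Omega_subst_form.
      - now constructor.
      - eapply agree_Omega_env, Ha. }
    apply s_all1_l with u; auto using s_refl, wf_fsubst.
    + now apply wf_fsubst.
    + apply s_refl. now apply wf_fsubst.
  - intros n T Hn HT IH s tau rho Hr Ha P HP. cbn [subst_form].
    (* The bound variable does not occur in [T], so the arbitrary family [P] can be paired with a
       mere variable, which is a restricted instance. *)
    assert (Hag : agree E false T (pcons n (pid n 0) tau) (pcons n P rho)).
    { apply agree_pcons; [exact Ha|]. intros c Hc. unfold occurs in Hn.
      apply orb_false_iff in Hn. destruct c; intuition congruence. }
    assert (Hr' : adm_env E (pcons n P rho)) by now apply adm_pcons.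
    specialize (IH s _ _ Hr' Hag). rewrite <- inst2_subst_form in IH.
    apply (closed_sem E T s _ Hr' _ IH).
    assert (Hw : wf (All2 n (subst_form s (up_pr n tau) T))).
    { apply wf_Omega_neg, (proj2 Omega_subst_form (All2 n T)).
      - now constructor.
      - eapply agree_Omega_env, Ha. }
    assert (Hw' : wf (inst2 n (subst_form s (up_pr n tau) T) (pid n 0))).
    { rewrite inst2_pid. now apply wf_pren. }
    apply s_all2_l with (pid n 0); auto using s_refl.
    intros _. left. now exists 0.
Qed.

(** * Soundness of typing, and its combination with completeness *)

Lemma lookup_map (f : formula -> formula) x (G : ctx) B :
  lookup x (map (fun p => (fst p, f (snd p))) G) = Some B ->
  exists A, lookup x G = Some A /\ B = f A.
Proof.
  induction G as [|[y A] G IH]; cbn; [discriminate|].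
  destruct (x =? y); [intros [= <-]; eauto|auto].
Qed.

(** The term is typed again in a context [D] that need only provide, for each hypothesis of [G], a
    type in its interpretation. Thus [D] stays fixed when a quantifier introduction shifts [G]. *)
Lemma deriv_sound r E G t A : deriv r E G t A -> normal t ->
  forall s rho D, adm_env E rho -> Omega_ctx D ->
  (forall x B, lookup x G = Some B -> exists C, lookup x D = Some C /\ sem E B s rho (EF C)) ->
  sem E A s rho (EL D t).
Proof.
  induction 1; intros Hn env0 rho D0 Hr HD HG.
  - destruct (HG _ _ e) as (C & HC & HS). apply (closed_sem E A env0 rho Hr C HS).
    now apply styping_ax.
  (* The body is handled for every negative [C] in the interpretation of the domain, as the second
     disjunct of [arrow] asks. *)
  - right. intros C HC HS. apply IHderiv; auto.
    + inversion Hn; subst; [inversion H0 | assumption].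
    + now constructor.
    + cbn. intros y B'. destruct (y =? x); [intros [= <-]; eauto | auto].
  - assert (Ht : neutral t /\ normal u) by (inversion Hn; subst; inversion H1; subst; auto).
    destruct Ht as [Ht Hu].
    specialize (IHderiv1 (nf_ne _ Ht) env0 rho D0 Hr HD HG).
    specialize (IHderiv2 Hu env0 rho D0 Hr HD HG).
    (* A neutral function is not an abstraction, so only the recorded arrow remains; the argument is
       typed with its positive domain [A']. *)
    destruct IHderiv1 as [(A' & B' & H1 & H2 & H3 & H4) | Hx].
    + apply (closed_sem E B env0 rho Hr B' H4). apply styping_app with A'; auto.
      apply (H3 _ IHderiv2).
    + destruct Ht; contradiction.
  - intro u. apply IHderiv; auto. intros x B Hx.
    apply (lookup_map shift1) in Hx. destruct Hx as (B' & HB & ->). rewrite sem_shift1. auto.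
  - rewrite inst1_sem. now apply IHderiv.
  - intros P HP. apply IHderiv; auto using adm_pcons. intros x B Hx.
    apply (lookup_map (shift2 n)) in Hx. destruct Hx as (B' & HB & ->). rewrite sem_shift2. auto.
  - unfold inst2. rewrite sem_pscons. apply (IHderiv Hn env0 rho D0 Hr HD HG). now apply adm_sem.
  - specialize (IHderiv Hn env0 rho D0 Hr HD HG).
    (* The equational typing rule is treated as a subtyping step. *)
    apply (sub_sound false E (inst1 A u) (inst1 A v)); auto.
    apply sub_eq_step; [|assumption]. now apply wf_fsubst_inv in w0.
  - apply (sub_sound _ _ _ _ s env0 rho Hr). now apply IHderiv.
  (* [Ycomb] is a redex, so a term headed by it is not normal. *)
  - exfalso. inversion Hn as [v Hv |]; subst. inversion Hv as [| v w' HY]; subst.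
    inversion HY as [| v' w' Hh]; subst. inversion Hh.
Qed.

(** In the canonical environment each predicate variable denotes its own down-set. The negative half
    of [completeness] puts every hypothesis into its interpretation, soundness moves the sequent
    into that of [A], and the positive half reads off a restricted typing. *)
Lemma typing_complete r E G t A : deriv r E G t A -> normal t -> Omega_ctx G -> Omega_pos A ->
  styping E G t A.
Proof.
  intros d Hn HG HA.
  set (rho := (fun _ i ts => down E (PVar i ts)) : env).
  assert (Hr : adm_env E rho) by (intros m i; apply adm_var).
  assert (Hag : forall b B, agree E b B pid rho) by (intros b B m i c _; apply approx_var).
  assert (Hid : forall B, subst_form TVar pid B = B).
  { intro B. now rewrite subst_form_pid, fsubst_id. }
  rewrite <- (Hid A).
  apply (proj1 (completeness E) A HA TVar pid rho Hr (Hag _ _) (EL G t)).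
  apply (deriv_sound r E G t A); auto. intros x B Hx. exists B. split; [assumption|].
  rewrite <- (Hid B) at 2. apply (proj2 (completeness E)); auto.
  apply lookup_In in Hx. unfold Omega_ctx in HG. rewrite Forall_forall in HG.
  apply (HG _ Hx).
Qed.

(** * Rebuilding a derivation together with its list of judgements *)

Lemma judgs_self r E G t A (d : deriv r E G t A) : In (G, t, A) (judgs d).
Proof. destruct d; now left. Qed.

Lemma wf_Omega_ctx G : Omega_ctx G -> wf_ctx G.
Proof. apply Forall_impl. intros p. apply wf_Omega_neg. Qed.

Lemma app_args_strip t a : In a (app_args t) -> In a (app_args (strip_lams t)).
Proof. destruct t; cbn; tauto. Qed.

(** The part of [in_STE] that lies strictly below the term. *)
Definition in_args (u t : lterm) : Prop :=
  exists a, In a (app_args (strip_lams t)) /\ in_STE u a.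

(** Positivity is claimed only strictly below the term: inside the derivation the term may be the
    head of an application, whose type need not be positive. The positive type of the whole term is
    supplied at the root by the theorem. *)
Lemma styping_deriv E G t A : styping E G t A ->
  exists d : deriv true E G t A,
    (forall D s B, In (D, s, B) (judgs d) -> Omega_ctx D) /\
    (forall u, in_args u t -> exists D B, In (D, u, B) (judgs d) /\ Omega_pos B).
Proof.
  intro H. pose proof (styping_ctx _ _ _ _ H) as HG. pose proof (wf_Omega_ctx _ HG) as Hc.
  pose proof (styping_wf _ _ _ _ H) as Hw.
  induction H.
  - exists (d_ax true E G x A Hc Hw H0). split.
    + intros D s B [[= <- <- <-] | []]. assumption.
    + intros u (a & [] & _).
  - destruct IHstyping as (d & H1 & H2); eauto using styping_ctx, wf_Omega_ctx, styping_wf.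
    exists (d_lam true E G x t A B Hc Hw d). split.
    + intros D s B' [[= <- <- <-] | Hi]; eauto.
    + intros u Hu. destruct (H2 u Hu) as (D & B' & Hi & HB). exists D, B'. split; [now right|assumption].
  - destruct IHstyping1 as (d1 & H3 & H4); eauto using styping_wf.
    destruct IHstyping2 as (d2 & H5 & H6); eauto using styping_wf.
    exists (d_app true E G t u A B Hc Hw d1 d2). split.
    + intros D s B' [[= <- <- <-] | Hi]; auto. apply in_app_or in Hi as [Hi | Hi]; eauto.
    + intros v (a & Ha & Hv). cbn in Ha. apply in_app_or in Ha as [Ha | [<- | []]].
      * apply app_args_strip in Ha. destruct (H4 v) as (D & B' & Hi & HB); [now exists a|].
        exists D, B'. split; [|assumption]. right. apply in_or_app. now left.
      (* Either the last argument itself, whose type is positive by [styping_app], or an element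
         strictly below it. *)
      * inversion Hv; subst.
        -- exists G, A. split; [|assumption]. right. apply in_or_app. right. apply judgs_self.
        -- destruct (H6 v) as (D & B' & Hi & HB); [now exists ti|].
           exists D, B'. split; [|assumption]. right. apply in_or_app. now right.
  - destruct IHstyping as (d & H1 & H2); eauto using styping_ctx, wf_Omega_ctx, styping_wf.
    exists (d_all1_i true E G t A Hc Hw d). split.
    + intros D s B' [[= <- <- <-] | Hi]; eauto.
    + intros u Hu. destruct (H2 u Hu) as (D & B' & Hi & HB). exists D, B'. split; [now right|assumption].
  - destruct IHstyping as (d & H1 & H2); eauto using styping_ctx, wf_Omega_ctx, styping_wf.
    exists (d_all2_i true E G t n A Hc Hw d). split.
    + intros D s B' [[= <- <- <-] | Hi]; eauto.
    + intros u Hu. destruct (H2 u Hu) as (D & B' & Hi & HB). exists D, B'. split; [now right|assumption].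
  - destruct IHstyping as (d & H1 & H2); eauto using styping_wf.
    exists (d_sub true E G t A B Hc Hw H d). split.
    + intros D s B' [[= <- <- <-] | Hi]; eauto.
    + intros u Hu. destruct (H2 u Hu) as (D & B' & Hi & HB). exists D, B'. split; [now right|assumption].
Qed.

Theorem theorem5p2 (E : term -> term -> Prop) (Gamma : ctx) (A : formula) (t : lterm) :
  NoDup (map fst Gamma) ->
  Forall (fun p => Omega_neg (snd p)) Gamma ->
  Omega_pos A ->
  normal t ->
  deriv false E Gamma t A ->
  exists d : deriv true E Gamma t A,
    (forall Delta s B, In (Delta, s, B) (judgs d) ->
       forall x C, In (x, C) Delta -> Omega_neg C) /\
    (forall u, in_STE u t ->
       exists Delta B, In (Delta, u, B) (judgs d) /\ Omega_pos B).
Proof.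
  intros _ HG HA Hn d0.
  destruct (styping_deriv E Gamma t A) as (d & H1 & H2); [now apply typing_complete with false|].
  exists d. split.
  - intros D s B Hi x C Hx. apply H1 in Hi. unfold Omega_ctx in Hi.
    rewrite Forall_forall in Hi. apply (Hi _ Hx).
  - intros u Hu. inversion Hu; subst.
    + exists Gamma, A. split; [apply judgs_self | assumption].
    + apply H2. now exists ti.
Qed.
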